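(* Let $\Omega\subset\mathbb R^d$ be a bounded open set with $C^2$ boundary, let $s,\sigma\in(0,1)$ and $T>0$. If $(u,w,\zeta)$ is a Neumann weak solution on $(0,T)$ (Definition A of the context), then $(u|_\Omega,w|_\Omega,\zeta)$ is a regional weak solution on $(0,T)$ (Definition B of the context). Conversely, if $(u,w,\zeta)$ is a regional weak solution on $(0,T)$, and we extend $u$ and $w$ to functions $\tilde u,\tilde w$ (with $\tilde u=u$, $\tilde w=w$ in $\Omega$) by setting $$\tilde u(x,t)=\frac{\int_\Omega\frac{u(y,t)}{|x-y|^{d+2s}}\,dy}{\int_\Omega\frac{dy}{|x-y|^{d+2s}}},\qquad\tilde w(x,t)=\frac{\int_\Omega\frac{w(y,t)}{|x-y|^{d+2\sigma}}\,dy}{\int_\Omega\frac{dy}{|x-y|^{d+2\sigma}}}$$ for every $(x,t)\in(\mathbb R^d\setminus\overline\Omega)\times(0,T)$, then $(\tilde u,\tilde w,\zeta)$ is a Neumann weak solution on $(0,T)$.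
   Context: Potential: $F=\Gamma+\Pi$ where (i) $\Gamma:\mathbb R\to[0,+\infty]$ is proper, convex, lower semicontinuous with $\Gamma(0)=0$; $\gamma:=\partial\Gamma$ is its subdifferential; (ii) $\pi:\mathbb R\to\mathbb R$ is Lipschitz with $\pi(0)=0$, $\Pi(z):=\int_0^z\pi(r)\,dr$; (iii) there are $p\in(0,2)$, $a_1,a_2\ge0$ with $F(r)\ge-a_1|r|^p-a_2$ for every $r\in\mathbb R$. Neumann framework. $Q(\Omega):=\mathbb R^{2d}\setminus\big((\mathbb R^d\setminus\Omega)\times(\mathbb R^d\setminus\Omega)\big)$. For $s\in(0,1)$, $\|u\|_{\mathcal H^s_\Omega}^2:=\frac{1-s}2\iint_{Q(\Omega)}\frac{|u(x)-u(y)|^2}{|x-y|^{d+2s}}\,dx\,dy$ and $\mathcal H^s_\Omega:=\{u:\mathbb R^d\to\mathbb R:\ u\in L^2(\Omega),\ \|u\|_{\mathcal H^s_\Omega}<+\infty\}$, a Hilbert space with norm $\|\cdot\|_{L^2(\Omega)}+\|\cdot\|_{\mathcal H^s_\Omega}$. For $u,v\in\mathcal H^s_\Omega$, $\langle\mathfrak D^su,v\rangle:=\frac{1-s}2\iint_{Q(\Omega)}\frac{(u(x)-u(y))(v(x)-v(y))}{|x-y|^{d+2s}}\,dx\,dy$. A function $v$ with $v|_\Omega\in L^2(\Omega)$ is regarded as an element of $(\mathcal H^s_\Omega)'$ via $\varphi\mapsto\int_\Omega v\varphi\,dx$; similarly for $\sigma$ in place of $s$. Definition A (Neumann weak solution,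 for an initial datum $u_0:\mathbb R^d\to\mathbb R$ with $u_0\in H^s(\Omega)$): a triple $(u,w,\zeta)$ with $u\in L^\infty(0,T;\mathcal H^s_\Omega)\cap W^{1,2}(0,T;(\mathcal H^\sigma_\Omega)')$, $w\in L^2(0,T;\mathcal H^\sigma_\Omega)$, $\zeta\in L^2(0,T;L^2(\Omega))$, $\zeta\in\gamma(u)$ a.e. in $\Omega\times(0,T)$, such that for a.e. $t\in(0,T)$: $\partial_t(u|_\Omega)+\mathfrak D^\sigma w=0$ in $(\mathcal H^\sigma_\Omega)'$ and $w|_\Omega=\mathfrak D^su+\zeta+\pi(u|_\Omega)$ in $(\mathcal H^s_\Omega)'$, with $u(0)=u_0$ a.e. in $\Omega$. (This is the weak formulation of $\partial_tu+(-\Delta)^\sigma w=0$, $w=(-\Delta)^su+\zeta+\pi(u)$ in $\Omega$ with fractional Neumann conditions $\mathcal N_\sigma w=0$, $\mathcal N_su=0$ in $\mathbb R^d\setminus\Omega$, where $\mathcal N_su(x):=(1-s)\int_\Omega\frac{u(x)-u(y)}{|x-y|^{d+2s}}\,dy$.) Regional framework. For $s\in(0,1)$ and $x,y\in\Omega$ let $$K_\Omega^s(x,y):=(1-s)\left(\frac1{|x-y|^{d+2s}}+\int_{\mathbb R^d\setminus\Omega}\frac{dz}{|x-z|^{d+2s}|y-z|^{d+2s}\int_\Omega\frac{d\eta}{|z-\eta|^{d+2s}}}\right).$$ $\mathcal W^{K^s_\Omega,2}(\Omega):=\{u\in L^2(\Omega):\ \|u\|_{K^s_\Omega,2}^2:=\iint_{\Omega^2}|u(x)-u(y)|^2K^s_\Omega(x,y)\,dx\,dy<+\infty\}$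 with norm $\|\cdot\|_{L^2(\Omega)}+\|\cdot\|_{K^s_\Omega,2}$. For $u,v\in\mathcal W^{K^s_\Omega,2}(\Omega)$, $\langle\mathfrak I_\Omega u,v\rangle:=\frac12\iint_{\Omega^2}(u(x)-u(y))(v(x)-v(y))K^s_\Omega(x,y)\,dx\,dy$. Let $X:=\mathcal W^{K^\sigma_\Omega,2}(\Omega)$ and for $u,v\in X$, $\langle\mathfrak Lu,v\rangle:=\frac12\iint_{\Omega^2}(u(x)-u(y))(v(x)-v(y))K^\sigma_\Omega(x,y)\,dx\,dy$. Elements of $L^2(\Omega)$ are regarded as elements of $X'$ and of $(\mathcal W^{K^s_\Omega,2}(\Omega))'$ through the $L^2(\Omega)$ scalar product. Definition B (regional weak solution, for an initial datum $u_0\in\mathcal W^{K^s_\Omega,2}(\Omega)$): a triple $(u,w,\zeta)$ with $u\in L^\infty(0,T;\mathcal W^{K^s_\Omega,2}(\Omega))\cap W^{1,2}(0,T;X')$, $w\in L^2(0,T;X)$, $\zeta\in L^2(0,T;L^2(\Omega))$, $\zeta\in\gamma(u)$ a.e. in $\Omega\times(0,T)$, such that for a.e. $t\in(0,T)$: $\partial_tu+\mathfrak Lw=0$ in $X'$ and $w=\mathfrak I_\Omega u+\zeta+\pi(u)$ in $(\mathcal W^{K^s_\Omega,2}(\Omega))'$, with $u(0)=u_0$ a.e. in $\Omega$. In both implications the initial data agree on $\Omega$; only the values of the initial datum in $\Omega$ matter. $u(0)$ is the value of the representative in $C([0,T];L^2(\Omega))$. *)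

(* Defs.v *)
From HB Require Import structures.
From mathcomp Require Import all_boot all_order all_algebra.
From mathcomp Require Import all_classical all_reals all_analysis.

Set Implicit Arguments.
Unset Strict Implicit.
Unset Printing Implicit Defensive.

Import Order.TTheory GRing.Theory Num.Theory.
Import numFieldNormedType.Exports.

Local Open Scope classical_set_scope.
Local Open Scope ring_scope.

(* 'rV[R]_d carries the Borel sigma-algebra, generated by the coordinates. *)
Definition rV_display : measure_display.
Proof. exact: default_measure_display. Qed.

Section rV_measurable.
Context (R : realType) (d : nat).

Let coord (i : 'I_d) (x : 'rV[R]_d) : R := x ord0 i.

Let rV_set0 : g_sigma_preimage coord set0.
Proof. exact: sigma_algebra0. Qed.

Let rV_setC A : g_sigma_preimage coord A -> g_sigma_preimage coord (~` A).
Proof. exact: sigma_algebraC. Qed.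

Let rV_bigcup (F : (set 'rV[R]_d)^nat) :
  (forall i, g_sigma_preimage coord (F i)) ->
  g_sigma_preimage coord (\bigcup_i (F i)).
Proof. exact: sigma_algebra_bigcup. Qed.

HB.instance Definition _ := @isMeasurable.Build rV_display
  'rV[R]_d (g_sigma_preimage coord) rV_set0 rV_setC rV_bigcup.

Lemma measurable_rV_coord (i : 'I_d) :
  measurable_fun [set: 'rV[R]_d] (fun x : 'rV[R]_d => x ord0 i).
Proof.
move=> _ Y mY; rewrite setTI; apply: sub_sigma_algebra => /=.
rewrite -bigcup_seq/=; exists i => /=; first by rewrite mem_index_enum.
by exists Y => //; rewrite setTI.
Qed.

Lemma measurable_fun_rV d0 (T0 : measurableType d0) (f : T0 -> 'rV[R]_d) :
  (forall i, measurable_fun [set: T0] (fun t => f t ord0 i)) ->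
  measurable_fun [set: T0] f.
Proof.
move=> mf; apply: (@measurability _ _ _ _ _ _
  (\big[setU/set0]_(i < d) preimage_set_system setT (coord i) measurable)) => //.
move=> _ [A + <-].
rewrite -bigcup_seq => -[i _ [B mB <-]].
rewrite !setTI -comp_preimage -[X in measurable X]setTI.
exact: (mf i measurableT B mB).
Qed.

End rV_measurable.

(* Lebesgue measure on R^d, by recursion on d as a product measure. *)
Section lebesgue_measure_rV.
Context (R : realType).

Definition cons_rV n (p : measurableTypeR R * 'rV[R]_n) : 'rV[R]_n.+1 :=
  \row_i oapp (p.2 ord0) p.1 (unlift ord0 i).

Definition uncons_rV n (x : 'rV[R]_n.+1) : measurableTypeR R * 'rV[R]_n :=
  (x ord0 ord0, \row_j x ord0 (lift ord0 j)).

Lemma cons_rVK n : cancel (@cons_rV n) (@uncons_rV n).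
Proof.
move=> [a v]; rewrite /uncons_rV mxE unlift_none /=; congr pair.
by apply/rowP => j; rewrite !mxE liftK.
Qed.

Lemma measurable_cons_rV n : measurable_fun setT (@cons_rV n).
Proof.
apply: measurable_fun_rV => i; rewrite /cons_rV.
under eq_fun do rewrite mxE.
case: unliftP => [j _|_] /=; last exact: measurable_fst.
apply: (measurableT_comp (f := fun v : 'rV[R]_n => v ord0 j) (g := snd)).
  exact: measurable_rV_coord.
exact: measurable_snd.
Qed.

Lemma measurable_uncons_rV n : measurable_fun setT (@uncons_rV n).
Proof.
apply: (@measurable_fun_pair _ _ _ _ _ _ (fun x : 'rV[R]_n.+1 => x ord0 ord0)
  (fun x : 'rV[R]_n.+1 => \row_j x ord0 (lift ord0 j))).
  exact: measurable_rV_coord.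
apply: measurable_fun_rV => i /=.
under eq_fun do rewrite mxE.
exact: measurable_rV_coord.
Qed.

Section step.
Context (n : nat) (m : {sigma_finite_measure set 'rV[R]_n -> \bar R}).

Definition leb_rV_step : set 'rV[R]_n.+1 -> \bar R :=
  pushforward (@lebesgue_measure R \x m)%E (@cons_rV n).

HB.instance Definition _ := Measure.copy leb_rV_step
  (measure_function_pushforward__canonical__measure_function_Measure
     (@lebesgue_measure R \x m)%E (@measurable_cons_rV n)).

Let step_sigma_finite : sigma_finite setT leb_rV_step.
Proof.
have /sigma_finiteP[F [TF ndF Foo]] := sigma_finiteT (@lebesgue_measure R).
have /sigma_finiteP[G [TG ndG Goo]] := sigma_finiteT m.
exists (fun i => @uncons_rV n @^-1` (F i `*` G i)).
  rewrite -preimage_bigcup (_ : \bigcup_i _ = setT) ?preimage_setT//.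
  rewrite -subTset => -[x y] _.
  have [i _ Fx] : (\bigcup_i F i) x by rewrite -TF.
  have [j _ Gy] : (\bigcup_i G i) y by rewrite -TG.
  exists (maxn i j) => //; split => /=.
  - by move: x Fx; exact/subsetPset/ndF/leq_maxl.
  - by move: y Gy; exact/subsetPset/ndG/leq_maxr.
move=> i; have [mF Fi] := Foo i; have [mG Gi] := Goo i; split.
  rewrite -[X in measurable X]setTI; apply: measurable_uncons_rV => //.
  exact: measurableX.
rewrite /leb_rV_step /pushforward -comp_preimage.
rewrite (_ : _ \o _ = id); last by apply/funext => p; exact: cons_rVK.
rewrite preimage_id product_measure1E//.
by rewrite lte_mul_pinfty// ge0_fin_numE.
Qed.

HB.instance Definition _ :=
  Measure_isSigmaFinite.Build _ _ _ leb_rV_step step_sigma_finite.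

End step.

Fixpoint leb_rV n : {sigma_finite_measure set 'rV[R]_n -> \bar R} :=
  if n is n'.+1 then leb_rV_step (leb_rV n') else \d_(0 : 'rV[R]_0).

End lebesgue_measure_rV.

(* Almost everywhere equality with a Borel function, i.e. measurability with
   respect to the completed sigma-algebra. *)
Definition ae_measurable d (T : measurableType d) (R : realType)
    (mu : {measure set T -> \bar R}) (D : set T) (f : T -> R) : Prop :=
  exists2 g : T -> R, measurable_fun setT g &
    {ae mu, forall x, D x -> f x = g x}.

Section domains.
Context (R : realType) (d : nat).

Definition eucl (x : 'rV[R]_d) : R := Num.sqrt (\sum_i x ord0 i ^+ 2).

Definition partial_derive (i : 'I_d) (f : 'rV[R]_d -> R) : 'rV[R]_d -> R :=
  fun x => 'D_(delta_mx ord0 i) f x.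

Definition C1 (f : 'rV[R]_d -> R) : Prop :=
  [/\ continuous f,
      forall i x, derivable f x (delta_mx ord0 i) &
      forall i, continuous (partial_derive i f)].

Definition C2 (f : 'rV[R]_d -> R) : Prop :=
  C1 f /\ forall i, C1 (partial_derive i f).

(* Near each boundary point and after relabelling and reorienting the axes,
   Om lies above the graph of a C^2 function of the other d - 1 coordinates. *)
Definition C2_boundary (Om : set 'rV[R]_d) : Prop :=
  forall x0, (closure Om `\` interior Om) x0 ->
  exists (r : R) (i : 'I_d) (b : bool) (g : 'rV[R]_d -> R),
    [/\ 0 < r, C2 g,
        forall x y : 'rV[R]_d,
          (forall j, j != i -> x ord0 j = y ord0 j) -> g x = g y &
        forall x : 'rV[R]_d, eucl (x - x0) < r ->
          (Om x <-> g x < (-1) ^+ b * x ord0 i)].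

End domains.

Section potential.
Context (R : realType).

Definition proper_ereal (G : R -> \bar R) : Prop :=
  (exists x, G x < +oo)%E /\ (forall x, -oo < G x)%E.

Definition convex_ereal (G : R -> \bar R) : Prop :=
  forall x y t : R, 0 <= t <= 1 ->
    (G (t * x + (1 - t) * y)%R <= t%:E * G x + (1 - t)%:E * G y)%E.

Definition subdiff (G : R -> \bar R) (r : R) : set R :=
  [set z | (G r < +oo)%E /\ forall y, (G r + (z * (y - r))%:E <= G y)%E].

Definition primitive0 (f : R -> R) (z : R) : R :=
  if 0 <= z then \int[lebesgue_measure]_(r in `[0, z]) f r
  else - \int[lebesgue_measure]_(r in `[z, 0]) f r.

Definition subquadratic_below (F : R -> \bar R) : Prop :=
  exists p a1 a2 : R, [/\ 0 < p < 2, 0 <= a1, 0 <= a2 &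
    forall r, ((- a1 * `|r| `^ p - a2)%:E <= F r)%E].

End potential.

(* A normed space of real functions on P, in which functions at distance zero
   are identified. [fnorm] is meaningful on [fdom] only. *)
Record fspace (R : realType) (P : Type) := FSpace {
  fdom : set (P -> R);
  fnorm : (P -> R) -> R }.

Section dual.
Context (R : realType) (P : Type) (E : fspace R P).

Definition dual_dom : set ((P -> R) -> R) :=
  [set l | (forall (a : R) u v, fdom E u -> fdom E v ->
              l (fun x => a * u x + v x) = a * l u + l v) /\
           exists C : R, forall v, fdom E v -> `|l v| <= C * fnorm E v].

Definition dual_norm (l : (P -> R) -> R) : R :=
  sup [set `|l v| | v in [set v | fdom E v /\ fnorm E v <= 1]].

Definition dual_space : fspace R (P -> R) := FSpace dual_dom dual_norm.

End dual.

Section bochner.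
Context (R : realType) (T : R) (P : Type) (E : fspace R P).
Implicit Types f : R -> P -> R.

Definition ae_time (P : R -> Prop) : Prop :=
  {ae @lebesgue_measure R, forall t : R, 0 < t < T -> P t}.

(* the simple function t |-> \sum_i 1_(sset i)(t) sval i *)
Record simple_function := Simple {
  ssize : nat;
  sset : 'I_ssize -> set R;
  sval : 'I_ssize -> P -> R;
  sset_measurable : forall i, measurable (sset i);
  sval_dom : forall i, fdom E (sval i) }.

Definition simple_fun (g : simple_function) (t : R) : P -> R :=
  fun x => \sum_i \1_(sset (s := g) i) t * sval i x.

Definition simple_int (g : simple_function) : P -> R :=
  fun x => \sum_i
    fine (lebesgue_measure (sset (s := g) i `&` `]0, T[)) * sval i x.

Definition simple_cvg (g : nat -> simple_function) f : Prop :=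
  ae_time (fun t => fdom E (f t) /\
    fnorm E (fun x => simple_fun (g n) t x - f t x) @[n --> \oo] --> (0 : R)).

Definition strongly_measurable f : Prop :=
  exists g : nat -> simple_function, simple_cvg g f.

Definition bochner_Linfty f : Prop :=
  strongly_measurable f /\ exists M : R, ae_time (fun t => fnorm E (f t) <= M).

Definition bochner_L2 f : Prop :=
  strongly_measurable f /\
  (\int[lebesgue_measure]_(t in `]0%R, T[) (fnorm E (f t) ^+ 2)%:E < +oo)%E.

Definition bochner_integral f (I : P -> R) : Prop :=
  fdom E I /\ exists g : nat -> simple_function,
    [/\ simple_cvg g f,
        (\int[lebesgue_measure]_(t in `]0%R, T[)
          (fnorm E (fun x => simple_fun (g n) t x - f t x))%:E)%E
            @[n --> \oo] --> 0%E &
        fnorm E (fun x => simple_int (g n) x - I x) @[n --> \oo] --> (0 : R)].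

Definition test_function (psi : R -> R) : Prop :=
  (forall n x, derivable (derive1n n psi) x 1) /\
  exists a b : R, [/\ 0 < a, b < T & forall t, ~~ (a <= t <= b) -> psi t = 0].

Definition weak_derivative f f' : Prop :=
  forall psi, test_function psi -> exists I : P -> R,
    bochner_integral (fun t x => derive1 psi t * f t x) I /\
    bochner_integral (fun t x => psi t * f' t x) (fun x => - I x).

Definition bochner_W12 f f' : Prop :=
  [/\ bochner_L2 f, bochner_L2 f' & weak_derivative f f'].

End bochner.

Section weak_solutions.
Context (R : realType) (d : nat) (Om : set 'rV[R]_d).
Local Notation mu := (leb_rV R d).
Local Notation mu2 := (leb_rV R d \x leb_rV R d)%E.
Implicit Types (s T : R) (v phi : 'rV[R]_d -> R).
Implicit Types (u w zeta : R -> 'rV[R]_d -> R).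

Definition L2_dom : set ('rV[R]_d -> R) :=
  [set v | ae_measurable mu Om v /\
           (\int[mu]_(x in Om) (v x ^+ 2)%:E < +oo)%E].

Definition L2_norm v : R := Num.sqrt (\int[mu]_(x in Om) (v x ^+ 2)).

(* L^2(Om): only the values on Om are relevant *)
Definition L2_space : fspace R 'rV[R]_d := FSpace L2_dom L2_norm.

(* a function on Om as a functional, through the L^2(Om) scalar product *)
Definition L2_embed v : ('rV[R]_d -> R) -> R :=
  fun phi => \int[mu]_(x in Om) (v x * phi x).

(* |x - y|^{-(d+2s)}, with value 0 on the (negligible) diagonal *)
Definition frac_kernel s (x y : 'rV[R]_d) : R :=
  (eucl (x - y) `^ (d%:R + 2 * s))^-1.

Definition fractional_sobolev s : set ('rV[R]_d -> R) :=
  [set v | L2_dom v /\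
    (\int[mu2]_(z in Om `*` Om)
       ((v z.1 - v z.2) ^+ 2 * frac_kernel s z.1 z.2)%:E < +oo)%E].

Definition Q_set : set ('rV[R]_d * 'rV[R]_d) := ~` (~` Om `*` ~` Om).

Definition neumann_energy s v : \bar R :=
  (((1 - s) / 2)%:E * \int[mu2]_(z in Q_set)
     ((v z.1 - v z.2) ^+ 2 * frac_kernel s z.1 z.2)%:E)%E.

Definition neumann_space s : fspace R 'rV[R]_d :=
  FSpace [set v | [/\ ae_measurable mu setT v, L2_dom v &
                      (neumann_energy s v < +oo)%E]]
         (fun v => L2_norm v + Num.sqrt (fine (neumann_energy s v))).

Definition neumann_form s v phi : R :=
  (1 - s) / 2 * \int[mu2]_(z in Q_set)
    ((v z.1 - v z.2) * (phi z.1 - phi z.2) * frac_kernel s z.1 z.2).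

Definition regional_kernel s (x y : 'rV[R]_d) : \bar R :=
  ((1 - s)%:E * ((frac_kernel s x y)%:E +
    \int[mu]_(z in ~` Om) ((frac_kernel s x z * frac_kernel s y z)%:E /
      \int[mu]_(eta in Om) (frac_kernel s z eta)%:E)))%E.

Definition regional_energy s v : \bar R :=
  (\int[mu2]_(z in Om `*` Om)
     (((v z.1 - v z.2) ^+ 2)%:E * regional_kernel s z.1 z.2))%E.

Definition regional_space s : fspace R 'rV[R]_d :=
  FSpace [set v | L2_dom v /\ (regional_energy s v < +oo)%E]
         (fun v => L2_norm v + Num.sqrt (fine (regional_energy s v))).

Definition regional_form s v phi : R :=
  2^-1 * fine (\int[mu2]_(z in Om `*` Om)
    (((v z.1 - v z.2) * (phi z.1 - phi z.2))%:E * regional_kernel s z.1 z.2))%E.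

(* zeta \in gamma(u) a.e. in Om x (0, T): elements of Bochner spaces over (0, T)
   need not be jointly measurable as functions of (t, x), but they have jointly
   measurable representatives. *)
Definition ae_selection T (gamma : R -> set R) u zeta : Prop :=
  exists U Z : R * 'rV[R]_d -> R,
    [/\ measurable_fun setT U, measurable_fun setT Z,
        ae_time T (fun t => {ae mu, forall x, Om x ->
          U (t, x) = u t x /\ Z (t, x) = zeta t x}) &
        {ae (@lebesgue_measure R \x mu)%E, forall z : R * 'rV[R]_d,
          0 < z.1 < T -> Om z.2 -> gamma (U z) (Z z)}].

(* u(0) = u0 a.e. in Om, u(0) being the value at 0 of the representative of u
   in C([0, T]; L^2(Om)) *)
Definition initial_value T u (u0 : 'rV[R]_d -> R) : Prop :=
  exists U : R -> 'rV[R]_d -> R,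
    [/\ forall t, 0 <= t <= T -> L2_dom (U t),
        forall t, 0 <= t <= T -> forall e, 0 < e -> exists2 delta, 0 < delta &
          forall t', 0 <= t' <= T -> `|t' - t| < delta ->
            L2_norm (fun x => U t' x - U t x) < e,
        ae_time T (fun t => {ae mu, forall x, Om x -> U t x = u t x}) &
        {ae mu, forall x, Om x -> U 0 x = u0 x}].

(* The weak formulation common to both frameworks: u takes its values in V and
   w in X, with operators given by the forms aV on V and aX on X. *)
Definition weak_solution (V X : fspace R 'rV[R]_d)
    (aV aX : ('rV[R]_d -> R) -> ('rV[R]_d -> R) -> R)
    (gamma : R -> set R) (pi : R -> R) T
    (u0 : 'rV[R]_d -> R) u w zeta : Prop :=
  [/\ bochner_Linfty T V u, bochner_L2 T X w, bochner_L2 T L2_space zeta,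
      ae_selection T gamma u zeta & initial_value T u u0] /\
  exists du : R -> ('rV[R]_d -> R) -> R,
    [/\ bochner_W12 T (dual_space X) (fun t => L2_embed (u t)) du,
        ae_time T (fun t => forall phi, fdom X phi ->
          du t phi + aX (w t) phi = 0) &
        ae_time T (fun t => forall phi, fdom V phi ->
          L2_embed (w t) phi =
          aV (u t) phi + L2_embed (zeta t) phi
            + L2_embed (fun x => pi (u t x)) phi)].

Definition neumann_weak_solution gamma pi s sigma T
    (u0 : 'rV[R]_d -> R) u w zeta : Prop :=
  fractional_sobolev s u0 /\
  weak_solution (neumann_space s) (neumann_space sigma)
    (neumann_form s) (neumann_form sigma) gamma pi T u0 u w zeta.

Definition regional_weak_solution gamma pi s sigma T
    (u0 : 'rV[R]_d -> R) u w zeta : Prop :=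
  fdom (regional_space s) u0 /\
  weak_solution (regional_space s) (regional_space sigma)
    (regional_form s) (regional_form sigma) gamma pi T u0 u w zeta.

(* A function on Om is represented by a function on R^d whose values off Om are
   irrelevant; the restriction of v to Om by its extension by zero. *)
Definition restrict_dom v : 'rV[R]_d -> R := patch (fun=> 0) Om v.

Definition neumann_average s v (x : 'rV[R]_d) : R :=
  (\int[mu]_(y in Om) (v y * frac_kernel s x y)) /
  (\int[mu]_(y in Om) frac_kernel s x y).

End weak_solutions.

(* Main.v *)
From HB Require Import structures.
Require Import Defs.
From mathcomp Require Import all_boot all_order all_algebra.
From mathcomp Require Import all_classical all_reals all_analysis.
From mathcomp Require Import measurable_realfun ring lra.

Set Implicit Arguments.
Unset Strict Implicit.
Unset Printing Implicit Defensive.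

Import Order.TTheory GRing.Theory Num.Theory.
Import numFieldNormedType.Exports.

Local Open Scope classical_set_scope.
Local Open Scope ring_scope.

(** The nonlocal part of the regional kernel is what remains of the interactions
    between [Om] and its complement once the exterior values are optimized. For
    a point [z] outside the closure of [Om], let [N z] be the integral of the
    fractional kernel seen from [z], and let [avg v z] be the mean of [v] in [Om]
    for that kernel. The decomposition of a second moment into variance and
    squared distance to the mean ([variance_identity]), integrated over [z],
    yields

      E_N(v) = E_R(v) / 2
               + (1 - s) * integral over z of N(z) * (v(z) - avg v(z))^2,

    where E_N is the Neumann energy and E_R the regional one ([energy_identity]).
    The boundary of [Om], where [N] may be infinite, is a null set because it is
    locally a graph ([C2_boundary_negligible]).

    Consequently, restriction to [Om] and extension by the mean are bounded
    linear maps between the Neumann and the regional spaces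
    ([bounded_linear_restriction], [bounded_linear_extension]). By polarization,
    the Neumann form of two functions equals their regional form as soon as one
    of them equals its mean outside ([neumann_form_average]): the other one may
    be arbitrary. Hence a Neumann solution tested against extensions of regional
    test functions solves the regional equations, and the extension of a regional
    solution, tested against an arbitrary Neumann test function, solves the
    Neumann equations.

    The functional setting follows the same two maps. Measurability, the Bochner
    norms and Bochner integrals pass through a bounded linear map
    ([bochner_integral_map]), and the time derivative, which takes its values in
    a dual space, is composed with the transpose of the map in the opposite
    direction ([weak_derivative_transpose]). The definitions admit integrands
    that are not measurable, for which the integral is a lower integral; this is
    monotone and blind to null sets all the same ([ge0_le_ae_integral]).

    The regional energy of the initial datum of a Neumann solution is finite by
    lower semicontinuity: the datum is the limit in L^2 of values of the solution
    at small times, whose energies are bounded ([regional_energy_limit]). *)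

(** * Lebesgue integrals of arbitrary functions *)

Section lower_integral.
Context d (T : measurableType d) (R : realType) (mu : {measure set T -> \bar R}).
Local Open Scope ereal_scope.
Import HBNNSimple.

(** The integral of a nonnegative function is a supremum over the measurable
    simple functions below it, so that it is monotone and insensitive to null
    sets even when the function is not measurable. *)
Lemma ge0_le_ae_integral (D : set T) (f g : T -> \bar R) :
  (forall x, D x -> 0 <= f x) -> (forall x, D x -> 0 <= g x) ->
  {ae mu, forall x, D x -> f x <= g x} ->
  \int[mu]_(x in D) f x <= \int[mu]_(x in D) g x.
Proof.
move=> f0 g0 [N [mN N0 sN]].
rewrite !ge0_integralE//.
apply: ge_ereal_sup => _ [h hf <-].
have mNc : measurable (~` N) by exact: measurableC.
apply: (@le_trans _ _ (sintegral mu (proj_nnsfun h mNc))); last first.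
  apply: ereal_sup_ubound; exists (proj_nnsfun h mNc) => // x.
  rewrite /= /patch mindicE; case: ifPn => xD.
    have [xN|xN] := boolP (x \in ~` N); last first.
      by rewrite mulr0; apply: g0; rewrite inE in xD.
    rewrite mulr1; have := hf x; rewrite /= /patch xD => /le_trans; apply.
    move: xN; rewrite inE /=; apply: contra_notP => fg; apply: sN => /=.
    by move=> /(_ (set_mem xD)).
  have := hf x; rewrite /= /patch (negbTE xD) lee_fin => h0.
  by rewrite lee_fin mulr_le0_ge0// .
rewrite -!integralT_nnsfun.
under [leRHS]eq_integral do rewrite /=.
rewrite le_eqVlt; apply/orP; left; apply/eqP.
apply: ge0_ae_eq_integral => //.
- exact/measurable_EFinP.
- exact/measurable_EFinP/measurable_funM.
- by move=> x _; rewrite lee_fin.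
- by move=> x _; rewrite lee_fin mulr_ge0.
- exists N; split => // x; apply: contra_notP => xN _ /=.
  by rewrite mindicE mem_set//= mulr1.
Qed.

Lemma ge0_ae_eq_integralW (D : set T) (f g : T -> \bar R) :
  (forall x, D x -> 0 <= f x) -> (forall x, D x -> 0 <= g x) ->
  {ae mu, forall x, D x -> f x = g x} ->
  \int[mu]_(x in D) f x = \int[mu]_(x in D) g x.
Proof.
move=> f0 g0 fg; apply/eqP; rewrite eq_le !ge0_le_ae_integral//.
  by apply: filterS fg => x fg Dx; rewrite fg.
by apply: filterS fg => x fg Dx; rewrite fg.
Qed.

Lemma ae_eq_integralW (D : set T) (f g : T -> \bar R) :
  {ae mu, forall x, D x -> f x = g x} ->
  \int[mu]_(x in D) f x = \int[mu]_(x in D) g x.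
Proof.
move=> fg; rewrite integralE [RHS]integralE; congr (_ - _).
  apply: ge0_ae_eq_integralW => //; apply: filterS fg => x fg Dx.
  by rewrite !funeposE fg.
apply: ge0_ae_eq_integralW => //; apply: filterS fg => x fg Dx.
by rewrite !funenegE fg.
Qed.

Lemma ge0_integralZl_le (D : set T) (f : T -> \bar R) (k : R) : (0 < k)%R ->
  (forall x, D x -> 0 <= f x) ->
  \int[mu]_(x in D) (k%:E * f x) <= k%:E * \int[mu]_(x in D) f x.
Proof.
move=> k0 f0; rewrite !ge0_integralE//; last first.
  by move=> x Dx; rewrite mule_ge0 ?lee_fin ?(ltW k0)// f0.
apply: ge_ereal_sup => _ [h hf <-].
have ki0 : (0 <= k^-1)%R by rewrite invr_ge0 ltW.
have -> : sintegral mu h = k%:E * sintegral mu (scale_nnsfun h ki0).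
  rewrite -!integralT_nnsfun -ge0_integralZl//.
  - apply: eq_integral => x _ /=.
    by rewrite -EFinM mulrA divff ?mul1r// gt_eqF.
  - exact/measurable_EFinP.
  - by move=> x _; rewrite lee_fin.
  - by rewrite lee_fin ltW.
rewrite lee_pmul2l//; apply: ereal_sup_ubound.
exists (scale_nnsfun h ki0) => // x /=.
have := hf x; rewrite /patch; case: ifPn => xD.
  by rewrite EFinM => hx; rewrite lee_pdivrMl.
by rewrite !lee_fin => h0; rewrite mulr_ge0_le0.
Qed.

End lower_integral.
(** * Bochner spaces under bounded linear maps *)

Section bounded_maps.
Context (R : realType).

Local Instance lebesgue_ae_filter :
  Filter (almost_everywhere (@lebesgue_measure R)).
Proof. exact: ae_filter_ringOfSetsType. Qed.

Lemma ae_timeS (T : R) (P Q : R -> Prop) : (forall t, 0 < t < T -> P t -> Q t) ->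
  ae_time T P -> ae_time T Q.
Proof.
by move=> PQ; apply: (@filterS _ _ lebesgue_ae_filter) => t Pt tT; exact: PQ (Pt tT).
Qed.

Lemma ae_timeI (T : R) (P Q : R -> Prop) :
  ae_time T P -> ae_time T Q -> ae_time T (fun t => P t /\ Q t).
Proof.
apply: (@filterS2 _ _ lebesgue_ae_filter) => t Pt Qt tT.
by split; [exact: Pt|exact: Qt].
Qed.

Definition seminormed (P : Type) (E : fspace R P) : Prop :=
  [/\ fdom E (fun=> 0),
      forall a u v, fdom E u -> fdom E v -> fdom E (fun x => a * u x + v x),
      forall v, 0 <= fnorm E v &
      forall a v, fdom E v -> fnorm E (fun x => a * v x) = `|a| * fnorm E v].

(** Linearity is required on the domain only, so that a map defined through an
    integral qualifies as soon as the integral converges there. *)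
Definition bounded_linear (P Q : Type) (E : fspace R P) (F : fspace R Q)
    (A : (P -> R) -> Q -> R) (C : R) : Prop :=
  [/\ 0 < C, forall v, fdom E v -> fdom F (A v),
      forall a u v, fdom E u -> fdom E v ->
        A (fun x => a * u x + v x) = (fun y => a * A u y + A v y) &
      forall v, fdom E v -> fnorm F (A v) <= C * fnorm E v].

Section seminormed_theory.
Context (P : Type) (E : fspace R P).
Hypothesis sE : seminormed E.

Lemma fdom0 : fdom E (fun=> 0). Proof. by case: sE. Qed.

Lemma fdomD a u v : fdom E u -> fdom E v -> fdom E (fun x => a * u x + v x).
Proof. by case: sE => _ + _ _; exact. Qed.

Lemma fnorm_ge0 v : 0 <= fnorm E v. Proof. by case: sE. Qed.

Lemma fnormZ a v : fdom E v -> fnorm E (fun x => a * v x) = `|a| * fnorm E v.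
Proof. by case: sE => _ _ _; exact. Qed.

Lemma fdomZ a v : fdom E v -> fdom E (fun x => a * v x).
Proof.
move=> Ev; have := fdomD a Ev fdom0.
by congr (fdom E _); apply/funext => x; rewrite addr0.
Qed.

Lemma fdomB u v : fdom E u -> fdom E v -> fdom E (fun x => u x - v x).
Proof.
move=> Eu Ev; have := fdomD (-1) Ev Eu.
by congr (fdom E _); apply/funext => x; rewrite mulN1r addrC.
Qed.

Lemma fdom_sum I (r : seq I) (c : I -> R) (v : I -> P -> R) :
  (forall i, fdom E (v i)) -> fdom E (fun x => \sum_(i <- r) c i * v i x).
Proof.
move=> Ev; elim: r => [|i r IH].
  by under eq_fun do rewrite big_nil; exact: fdom0.
by under eq_fun do rewrite big_cons; exact: fdomD.
Qed.

End seminormed_theory.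

Section bounded_linear_theory.
Context (P Q : Type) (E : fspace R P) (F : fspace R Q) (A : (P -> R) -> Q -> R)
  (C : R).
Hypotheses (sE : seminormed E) (bA : bounded_linear E F A C).

Lemma bounded_linear0 : A (fun=> 0) = fun=> 0.
Proof.
case: bA => _ _ lA _.
have := lA 1 _ _ (fdom0 sE) (fdom0 sE).
under [in A _]eq_fun do rewrite mulr0 addr0.
move=> A0; apply/funext => y; have := congr1 (fun h => h y) A0.
by rewrite mul1r => /eqP; rewrite addrC -subr_eq subrr => /eqP.
Qed.

Lemma bounded_linearB u v : fdom E u -> fdom E v ->
  A (fun x => u x - v x) = fun y => A u y - A v y.
Proof.
move=> Eu Ev; case: bA => _ _ lA _.
have := lA (-1) v u Ev Eu.
rewrite (_ : (fun x => -1 * v x + u x) = (fun x => u x - v x)); last first.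
  by apply/funext => x; rewrite mulN1r addrC.
by move=> ->; apply/funext => y; rewrite mulN1r addrC.
Qed.

Lemma bounded_linear_sum I (r : seq I) (c : I -> R) (v : I -> P -> R) :
  (forall i, fdom E (v i)) ->
  A (fun x => \sum_(i <- r) c i * v i x) = fun y => \sum_(i <- r) c i * A (v i) y.
Proof.
move=> Ev; elim: r => [|i r IH].
  under [in A _]eq_fun do rewrite big_nil.
  by rewrite bounded_linear0; apply/funext => y; rewrite big_nil.
under [in A _]eq_fun do rewrite big_cons.
case: bA => _ _ lA _; rewrite lA//; last exact: fdom_sum.
by rewrite IH; apply/funext => y; rewrite big_cons.
Qed.

Lemma bounded_linear_dom v : fdom E v -> fdom F (A v).
Proof. by case: bA => _ + _ _; exact. Qed.

Lemma bounded_linear_le v : fdom E v -> fnorm F (A v) <= C * fnorm E v.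
Proof. by case: bA => _ _ _; exact. Qed.

Lemma bounded_linear_gt0 : 0 < C. Proof. by case: bA. Qed.

End bounded_linear_theory.

Section bochner_map.
Context (T : R) (P Q : Type) (E : fspace R P) (F : fspace R Q)
  (A : (P -> R) -> Q -> R) (C : R).
Hypotheses (sE : seminormed E) (sF : seminormed F)
  (bA : bounded_linear E F A C).

(** Elements of the target are functions, and a representative may be changed on
    a null set that depends on the time: hence [f' t] is compared with [A (f t)]
    through the seminorm. *)
Definition represents_image (f : R -> P -> R) (f' : R -> Q -> R) : Prop :=
  forall t, 0 < t < T -> fdom E (f t) ->
  [/\ fdom F (f' t),
      forall v, fdom F v ->
        fnorm F (fun x => v x - f' t x) = fnorm F (fun x => v x - A (f t) x) &
      fnorm F (f' t) = fnorm F (A (f t))].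

Lemma represents_image_refl f f' :
  (forall t, 0 < t < T -> f' t = A (f t)) -> represents_image f f'.
Proof.
by move=> ff' t tT Ef; rewrite ff'//; split => //; exact: (bounded_linear_dom bA).
Qed.

Definition simple_map (g : simple_function E) : simple_function F :=
  Simple (sset_measurable (s := g))
    (fun i => bounded_linear_dom bA (sval_dom (s := g) i)).

Lemma simple_fun_dom (g : simple_function E) t : fdom E (simple_fun g t).
Proof. by apply: (fdom_sum sE) => i; exact: sval_dom. Qed.

Lemma simple_fun_map g t : simple_fun (simple_map g) t = A (simple_fun g t).
Proof.
rewrite /simple_fun (bounded_linear_sum sE bA)// => i; exact: sval_dom.
Qed.

Lemma simple_int_map g : simple_int T (simple_map g) = A (simple_int T g).
Proof.
rewrite /simple_int (bounded_linear_sum sE bA)// => i; exact: sval_dom.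
Qed.

Lemma simple_int_dom (g : simple_function E) : fdom E (simple_int T g).
Proof. by apply: (fdom_sum sE) => i; exact: sval_dom. Qed.

(** The estimate behind every transfer: simple approximations of [f] are mapped
    to simple approximations of its image, with an error at most [C] times the
    original one. *)
Lemma fnorm_simple_map_le g f f' t : represents_image f f' -> 0 < t < T ->
  fdom E (f t) ->
  fnorm F (fun x => simple_fun (simple_map g) t x - f' t x) <=
  C * fnorm E (fun x => simple_fun g t x - f t x).
Proof.
move=> ff' tT Ef; have [_ vE _] := ff' t tT Ef.
rewrite vE simple_fun_map; last exact/(bounded_linear_dom bA)/simple_fun_dom.
rewrite -(bounded_linearB bA)//; last exact: simple_fun_dom.
by apply: (bounded_linear_le bA); apply: (fdomB sE) => //; exact: simple_fun_dom.
Qed.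

Lemma simple_cvg_map g f f' : represents_image f f' -> simple_cvg T g f ->
  simple_cvg T (simple_map \o g) f'.
Proof.
move=> ff'; apply: ae_timeS => t tT [Ef gf].
split; first by have [] := ff' t tT Ef.
apply: (@squeeze_cvgr _ _ _ _ (fun=> 0)
  (fun n => C * fnorm E (fun x => simple_fun (g n) t x - f t x))).
- apply: nearW => n; rewrite (fnorm_ge0 sF)/=.
  exact: fnorm_simple_map_le.
- exact: cvg_cst.
- rewrite [X in _ --> X](_ : 0 = C * 0); last by rewrite mulr0.
  by apply: cvgMr.
Qed.

Lemma strongly_measurable_map f f' : represents_image f f' ->
  strongly_measurable T E f -> strongly_measurable T F f'.
Proof. by move=> ff' [g gf]; exists (simple_map \o g); exact: (simple_cvg_map ff'). Qed.

Lemma strongly_measurable_dom f : strongly_measurable T E f ->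
  ae_time T (fun t => fdom E (f t)).
Proof. by move=> [g]; apply: ae_timeS => t _ []. Qed.

Lemma fnorm_image_le f f' t : represents_image f f' -> 0 < t < T ->
  fdom E (f t) -> fnorm F (f' t) <= C * fnorm E (f t).
Proof. by move=> ff' tT Ef; have [_ _ ->] := ff' t tT Ef; exact: bounded_linear_le. Qed.

Lemma bochner_Linfty_map f f' : represents_image f f' ->
  bochner_Linfty T E f -> bochner_Linfty T F f'.
Proof.
move=> ff' [mf [M fM]]; split; first exact: strongly_measurable_map mf.
exists (C * M); apply: ae_timeS (ae_timeI (strongly_measurable_dom mf) fM).
move=> t tT [Ef fM']; apply: le_trans (fnorm_image_le ff' tT Ef) _.
by rewrite ler_pM2l ?(bounded_linear_gt0 bA).
Qed.

Lemma bochner_L2_map f f' : represents_image f f' ->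
  bochner_L2 T E f -> bochner_L2 T F f'.
Proof.
move=> ff' [mf fL2]; split; first exact: strongly_measurable_map mf.
have C0 : 0 < C ^+ 2 by rewrite exprn_gt0// (bounded_linear_gt0 bA).
apply: (@le_lt_trans _ _ ((C ^+ 2)%:E *
   \int[lebesgue_measure]_(t in `]0%R, T[) (fnorm E (f t) ^+ 2)%:E)%E); last first.
  by rewrite lte_mul_pinfty// ?lee_fin ?(ltW C0)// ge0_fin_numE.
apply: le_trans; last first.
  by apply: ge0_integralZl_le => // t _; rewrite lee_fin sqr_ge0.
apply: ge0_le_ae_integral.
- by move=> t _; rewrite lee_fin sqr_ge0.
- by move=> t _; rewrite mule_ge0// lee_fin ?sqr_ge0// ltW.
apply: (@filterS _ _ lebesgue_ae_filter) (strongly_measurable_dom mf) => t Ef.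
rewrite /= in_itv/= => tT; rewrite -EFinM lee_fin -exprMn.
rewrite ler_pXn2r ?nnegrE ?(fnorm_ge0 sF)//; last first.
  by rewrite mulr_ge0 ?(fnorm_ge0 sE)// ltW// (bounded_linear_gt0 bA).
exact: (fnorm_image_le ff' tT (Ef tT)).
Qed.

Lemma bochner_integral_map f f' I : represents_image f f' ->
  bochner_integral T E f I -> bochner_integral T F f' (A I).
Proof.
move=> ff' [EI [g [gf gf0 gI]]]; split; first exact: (bounded_linear_dom bA EI).
have C0 := bounded_linear_gt0 bA.
exists (simple_map \o g); split; first exact: simple_cvg_map gf.
- apply: (@squeeze_cvge _ _ _ _ (fun=> 0%E) _ (fun n => C%:E *
   \int[lebesgue_measure]_(t in `]0%R, T[)
     (fnorm E (fun x => simple_fun (g n) t x - f t x))%:E)%E).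
  + apply: nearW => n; rewrite integral_ge0/=; last first.
      by move=> t _; rewrite lee_fin (fnorm_ge0 sF).
    apply: le_trans; last first.
      by apply: ge0_integralZl_le => // t _; rewrite lee_fin (fnorm_ge0 sE).
    apply: ge0_le_ae_integral.
    * by move=> t _; rewrite lee_fin (fnorm_ge0 sF).
    * by move=> t _; rewrite mule_ge0// lee_fin ?(fnorm_ge0 sE)// ltW.
    * apply: (@filterS _ _ lebesgue_ae_filter) gf => t /[swap].
      rewrite [X in X -> _]/= in_itv/= => tT /(_ tT)[Ef _].
      rewrite -EFinM lee_fin; exact: fnorm_simple_map_le.
  + exact: cvg_cst.
  + rewrite [X in _ --> X](_ : 0%E = C%:E * 0)%E; last by rewrite mule0.
    exact: cvgeZl.
- apply: (@squeeze_cvgr _ _ _ _ (fun=> 0)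
    (fun n => C * fnorm E (fun x => simple_int T (g n) x - I x))).
  + apply: nearW => n; rewrite (fnorm_ge0 sF)/= simple_int_map.
    rewrite -(bounded_linearB bA)//; last exact: simple_int_dom.
    by apply: (bounded_linear_le bA); apply: (fdomB sE) => //; exact: simple_int_dom.
  + exact: cvg_cst.
  + rewrite [X in _ --> X](_ : 0 = C * 0); last by rewrite mulr0.
    by apply: cvgMr.
Qed.

End bochner_map.

Definition transpose (P Q : Type) (A : (P -> R) -> Q -> R)
  (l : (Q -> R) -> R) : (P -> R) -> R := fun v => l (A v).

Section dual_theory.
Context (P : Type) (E : fspace R P).
Hypothesis sE : seminormed E.

Lemma dual_norm_ge0 l : 0 <= dual_norm E l.
Proof.
rewrite /dual_norm; set S := (X in sup X).
have [hS|hS] := pselect (has_sup S); last by rewrite sup_out.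
have [x [v Ev _]] := hS.1; apply: le_trans (normr_ge0 (l v)) _.
by apply: (sup_upper_bound hS); exists v.
Qed.

Lemma dual_has_sup l : dual_dom E l ->
  has_sup [set `|l v| | v in [set v | fdom E v /\ fnorm E v <= 1]].
Proof.
move=> [_ [K lK]]; split.
  exists `|l (fun=> 0)|; exists (fun=> 0) => //; split; first exact: fdom0.
  have := fnormZ sE 0 (fdom0 sE); under [X in fnorm E X]eq_fun do rewrite mulr0.
  by move=> ->; rewrite normr0 mul0r.
exists `|K| => _ [v [Ev v1] <-]; apply: le_trans (lK v Ev) _.
apply: (@le_trans _ _ (`|K| * fnorm E v)).
  by rewrite ler_wpM2r ?(fnorm_ge0 sE)// ler_norm.
by rewrite ler_piMr.
Qed.

Lemma dual_homog l a v : dual_dom E l -> fdom E v -> l (fun x => a * v x) = a * l v.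
Proof.
move=> [lL _] Ev.
have l0 : l (fun=> 0) = 0.
  have := lL 1 _ _ (fdom0 sE) (fdom0 sE).
  under [in l _]eq_fun do rewrite mulr0 addr0.
  by rewrite mul1r => /eqP; rewrite addrC -subr_eq subrr => /eqP.
have := lL a _ _ Ev (fdom0 sE); rewrite l0 addr0 => <-.
by congr l; apply/funext => x; rewrite addr0.
Qed.

Lemma dual_norm_ub l v : dual_dom E l -> fdom E v ->
  `|l v| <= dual_norm E l * fnorm E v.
Proof.
move=> El Ev; have := fnorm_ge0 sE v; rewrite le_eqVlt => /predU1P[v0|v0].
  rewrite -v0 mulr0; have [_ [K lK]] := El.
  by have := lK v Ev; rewrite -v0 mulr0.
rewrite -ler_pdivrMr//; apply: (sup_upper_bound (dual_has_sup El)).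
exists (fun x => (fnorm E v)^-1 * v x).
  split; first exact: fdomZ.
  have vi : 0 <= (fnorm E v)^-1 by rewrite invr_ge0 ltW.
  by rewrite fnormZ// ger0_norm// mulVf ?gt_eqF.
rewrite (dual_homog _ El Ev) normrM [in RHS]mulrC ger0_norm// invr_ge0.
exact: ltW.
Qed.

End dual_theory.

Lemma seminormed_dual (P : Type) (E : fspace R P) :
  seminormed E -> seminormed (dual_space E).
Proof.
move=> sE; split.
- split => [a u v _ _|]; first by rewrite mulr0 addr0.
  by exists 0 => v _; rewrite normr0 mul0r.
- move=> a l m [lL [K lK]] [mL [K' mK]]; split.
    by move=> b u v Eu Ev; rewrite lL// mL//; ring.
  exists (`|a| * K + K') => v Ev; rewrite mulrDl.
  apply: le_trans (ler_normD _ _) (lerD _ (mK _ Ev)).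
  by rewrite normrM -mulrA ler_wpM2l// lK.
- exact: dual_norm_ge0.
- move=> a l El /=; have [->|a0] := eqVneq a 0.
    rewrite normr0 mul0r /dual_norm; set S := (X in sup X).
    rewrite (_ : S = [set 0]) ?sup1//; apply/seteqP; split.
      by move=> _ [v _ <-]; rewrite mul0r normr0.
    move=> _ ->; have [[_ [v Ev _]] _] := dual_has_sup sE El.
    by exists v => //; rewrite mul0r normr0.
  have le b m : b != 0 -> dual_dom E m ->
      dual_norm E (fun x => b * m x) <= `|b| * dual_norm E m.
    move=> b0 Em; apply: ge_sup.
      have [[_ [v Ev _]] _] := dual_has_sup sE Em.
      by exists `|b * m v|; exists v.
    move=> _ [v [Ev v1] <-]; rewrite normrM ler_wpM2l//.
    by apply: (sup_upper_bound (dual_has_sup sE Em)); exists v.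
  apply/eqP; rewrite eq_le le//=.
  have := le a^-1 (fun x => a * l x).
  rewrite invr_eq0 => /(_ a0).
  under [in dual_norm _ _]eq_fun do rewrite mulrA mulVf// mul1r.
  rewrite normfV ler_pdivlMl ?normr_gt0//; apply.
  case: El => lL [K lK]; split.
    by move=> b u v Eu Ev; rewrite lL//; ring.
  by exists (`|a| * K) => v Ev; rewrite normrM -mulrA ler_wpM2l// lK.
Qed.

(** Transposition preserves the operator bound, so that functionals follow
    functions, in the opposite direction. *)
Lemma bounded_linear_transpose (P Q : Type) (E : fspace R P) (F : fspace R Q)
    (A : (P -> R) -> Q -> R) (C : R) :
  seminormed E -> seminormed F -> bounded_linear E F A C ->
  bounded_linear (dual_space F) (dual_space E) (transpose A) C.
Proof.
move=> sE sF bA; have [C0 AF lA AC] := bA.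
have tdom l : dual_dom F l -> dual_dom E (transpose A l).
  move=> [lL [K lK]]; split.
    by move=> a u v Eu Ev; rewrite /transpose lA// lL//; exact: AF.
  exists (`|K| * C) => v Ev; apply: le_trans (lK _ (AF _ Ev)) _.
  apply: (@le_trans _ _ (`|K| * fnorm F (A v))).
    by rewrite ler_wpM2r ?(fnorm_ge0 sF)// ler_norm.
  by rewrite -mulrA ler_wpM2l// AC.
split => // l Fl /=; apply: ge_sup.
  have [[_ [v Ev _]] _] := dual_has_sup sE (tdom _ Fl).
  by exists `|transpose A l v|; exists v.
move=> _ [v [Ev v1] <-]; apply: le_trans (dual_norm_ub sF Fl (AF _ Ev)) _.
rewrite mulrC ler_wpM2r ?dual_norm_ge0//; apply: le_trans (AC _ Ev) _.
by rewrite ler_piMr// ltW.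
Qed.

(** The distributional derivative is tested by Bochner integrals in the dual,
    and these commute with the bounded map [transpose A]. *)
Lemma weak_derivative_transpose (T : R) (P Q : Type) (E : fspace R P)
    (F : fspace R Q) (A : (P -> R) -> Q -> R) (C : R)
    (f f' : R -> (Q -> R) -> R) (g g' : R -> (P -> R) -> R) :
  seminormed E -> seminormed F -> bounded_linear E F A C ->
  (forall t, 0 < t < T -> g t = transpose A (f t)) ->
  (forall t, 0 < t < T -> g' t = transpose A (f' t)) ->
  bochner_W12 T (dual_space F) f f' -> bochner_W12 T (dual_space E) g g'.
Proof.
move=> sE sF bA gf gf' [fL2 f'L2 ff'].
have bA' := bounded_linear_transpose sE sF bA.
have sE' := seminormed_dual sE; have sF' := seminormed_dual sF.
split.
- by apply: (bochner_L2_map sF' sE' bA') fL2; exact: (represents_image_refl bA').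
- by apply: (bochner_L2_map sF' sE' bA') f'L2; exact: (represents_image_refl bA').
- move=> psi psiT; have [I [fI f'I]] := ff' psi psiT.
  exists (transpose A I); split.
    apply: (bochner_integral_map sF' sE' bA') fI.
    by apply: (represents_image_refl bA') => t tT; rewrite gf.
  apply: (bochner_integral_map sF' sE' bA') f'I.
  by apply: (represents_image_refl bA') => t tT; rewrite gf'.
Qed.

End bounded_maps.
(** * Borel sets and Lebesgue measure on R^d *)

Section euclidean_space.
Context (R : realType) (d : nat).
Implicit Types (x y : 'rV[R]_d) (A : set 'rV[R]_d).

Lemma ball_rVP x (e : R) y : 0 < e ->
  ball x e y <-> forall i, `|x ord0 i - y ord0 i| < e.
Proof.
move=> e0; split.
  by move=> [_ h] i; have := h ord0 i.
by move=> h; split => // i j; rewrite ord1; exact: h.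
Qed.

(** Every open set is a countable union of cubes with rational centres. *)
Lemma open_measurable_rV A : open A -> measurable A.
Proof.
move=> oA.
pose cube (p : 'rV[rat]_d * nat) :=
  \bigcap_(i in [set: 'I_d])
    [set x : 'rV[R]_d | `|ratr (p.1 ord0 i) - x ord0 i| < p.2.+1%:R^-1].
have mcube p : measurable (cube p).
  apply: fin_bigcap_measurable => // i _.
  rewrite [X in measurable X](_ : _ = setT `&`
    (fun x : 'rV[R]_d => x ord0 i) @^-1` ball (ratr (p.1 ord0 i) : R) (p.2.+1%:R^-1)).
    apply: measurable_rV_coord => //; exact: measurable_ball.
  by rewrite setTI.
pose D := [set p | cube p `<=` A].
rewrite (_ : A = \bigcup_(p in D) cube p).
  rewrite bigcup_mkcond; apply: countable_bigcupT_measurable => // p.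
  by case: ifP.
apply/seteqP; split=> [x Ax|x [p Dp]]; last exact: Dp.
have /nbhs_ballP[e /= e0 eA] : nbhs x A by exact: open_nbhs_nbhs.
pose n := Num.truncn (2 / e); pose r : R := n.+1%:R^-1.
have r0 : 0 < r by rewrite invr_gt0.
have re : r + r <= e.
  rewrite -mulr2n -mulr_natr -ler_pdivlMr// /r -[leRHS]invrK lef_pV2 ?posrE//.
    by rewrite invf_div ltW// /n truncnS_gt.
  by rewrite invr_gt0 divr_gt0.
have H i : exists q : rat, `|ratr q - x ord0 i| < r.
  have : x ord0 i - r < x ord0 i + r by lra.
  move=> /rat_in_itvoo[q]; rewrite in_itv/= => /andP[q1 q2]; exists q.
  by rewrite ltr_norml; apply/andP; split; lra.
pose q : 'rV[rat]_d := \row_i sval (cid (H i)).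
have qx i : `|ratr (q ord0 i) - x ord0 i| < r by rewrite mxE; case: cid.
exists (q, n).
  move=> y yq; apply: eA; apply/ball_rVP => // i.
  have := qx i; have := yq i I; rewrite /= -/r => a b.
  rewrite (_ : x ord0 i - y ord0 i =
    (ratr (q ord0 i) - y ord0 i) - (ratr (q ord0 i) - x ord0 i)); last by ring.
  by apply: le_lt_trans (ler_normB _ _) _; apply: lt_le_trans re; exact: ltrD.
by move=> i _; exact: qx.
Qed.

Lemma closed_measurable_rV A : closed A -> measurable A.
Proof.
move=> cA; rewrite -[A]setCK; apply: measurableC; apply: open_measurable_rV.
exact: closed_openC.
Qed.

Lemma coord_le_eucl x i : `|x ord0 i| <= eucl x.
Proof.
rewrite /eucl -sqrtr_sqr ler_wsqrtr// (bigD1 i)//= lerDl.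
by apply: sumr_ge0 => j _; exact: sqr_ge0.
Qed.

Lemma eucl_lt x (r : R) : 0 < r ->
  (forall i, `|x ord0 i| < r / d.+1%:R) -> eucl x < r.
Proof.
move=> r0 xr; rewrite /eucl -[ltRHS]ger0_norm ?ltW// -sqrtr_sqr.
rewrite ltr_sqrt ?exprn_gt0//.
apply: (@le_lt_trans _ _ (\sum_(i < d) (r / d.+1%:R) ^+ 2)).
  apply: ler_sum => i _; rewrite -[leLHS]real_normK ?num_real//.
  by rewrite ler_pXn2r ?nnegrE ?normr_ge0 ?divr_ge0 ?(ltW r0)// ltW.
rewrite sumr_const card_ord -[ltLHS]mulr_natr exprMn -mulrA gtr_pMr ?exprn_gt0//.
have d0 : 0 < d.+1%:R :> R by [].
rewrite exprVn mulrC ltr_pdivrMr ?exprn_gt0// mul1r -natrX ltr_nat.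
by rewrite expnS expn1 (@leq_trans d.+1)// leq_pmulr.
Qed.

Lemma eucl_ball x (r : R) : 0 < r ->
  ball x (r / d.+1%:R) `<=` [set y | eucl (y - x) < r].
Proof.
move=> r0 y; have e0 : 0 < r / d.+1%:R by rewrite divr_gt0.
move=> /(ball_rVP _ _ e0) xy /=; apply: eucl_lt => // i.
by rewrite !mxE -normrN opprB.
Qed.

Lemma measurable_frac_kernel (s : R) :
  measurable_fun setT (fun z : 'rV[R]_d * 'rV[R]_d => frac_kernel s z.1 z.2).
Proof.
rewrite /frac_kernel; under eq_fun do rewrite -powRN.
apply: (measurableT_comp (measurable_powR _)).
apply: (measurableT_comp (continuous_measurable_fun (@sqrt_continuous R))).
apply: measurable_sum => i.
apply: measurable_funX; under eq_fun do rewrite !mxE.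
apply: measurable_funB.
  apply: (measurableT_comp (f := fun x : 'rV[R]_d => x ord0 i) (g := fst)) => //.
  exact: measurable_rV_coord.
apply: (measurableT_comp (f := fun x : 'rV[R]_d => x ord0 i) (g := snd)) => //.
exact: measurable_rV_coord.
Qed.

Lemma frac_kernel_ge0 (s : R) x y : 0 <= frac_kernel s x y.
Proof. by rewrite invr_ge0 powR_ge0. Qed.

Lemma frac_kernelC (s : R) x y : frac_kernel s x y = frac_kernel s y x.
Proof.
rewrite /frac_kernel /eucl; congr ((Num.sqrt _ `^ _)^-1).
by apply: eq_bigr => i _; rewrite !mxE -sqrrN opprB.
Qed.

(** The singularity of the kernel is the only obstruction to boundedness. *)
Lemma frac_kernel_bounded (s : R) A z : 0 < s -> ~ closure A z ->
  exists M : R, forall y, A y -> frac_kernel s z y <= M.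
Proof.
move=> s0 zA.
have /existsNP[B /not_implyP[nB AB]] : ~ (forall B, nbhs z B -> A `&` B !=set0) by [].
have /nbhs_ballP[e /= e0 eB] := nB.
exists (e `^ (d%:R + 2 * s))^-1 => y Ay.
have p0 : 0 < d%:R + 2 * s by rewrite ltr_wpDl// mulr_gt0.
suff ez : e <= eucl (z - y).
  rewrite /frac_kernel lef_pV2 ?posrE ?powR_gt0//; last exact: lt_le_trans ez.
  by apply: ge0_ler_powR; rewrite ?nnegrE ?sqrtr_ge0//; exact: ltW.
rewrite leNgt; apply/negP => zye; apply: AB; exists y; split => //.
apply: eB; apply/(ball_rVP _ _ e0) => i.
by apply: le_lt_trans zye; have := coord_le_eucl (z - y) i; rewrite !mxE.
Qed.

Lemma bounded_leb_rV A : bounded_set A -> exists M : R,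
  forall x i, A x -> `|x ord0 i| <= M.
Proof.
move=> [M [_ AM]]; exists (M + 1) => x i Ax.
have /AM/(_ x Ax)/= : M < M + 1 by rewrite ltrDl.
apply: le_trans; rewrite /Num.norm/= mx_normrE.
exact: (le_bigmax _ (fun ij => `|x ij.1 ij.2|) (ord0, i)).
Qed.

End euclidean_space.

Section lebesgue_rV.
Context (R : realType).

Lemma measurable_cube d (M : R) :
  measurable [set x : 'rV[R]_d | forall i, - M <= x ord0 i <= M].
Proof.
rewrite (_ : mkset _ = \bigcap_(i in [set: 'I_d])
    (fun x : 'rV[R]_d => x ord0 i) @^-1` `[- M, M]); last first.
  apply/seteqP; split=> x /= xM i => [_|]; first by rewrite /= in_itv/= xM.
  by have := xM i I; rewrite /= in_itv.
apply: fin_bigcap_measurable => // i _.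
by rewrite -[X in measurable X]setTI; exact: measurable_rV_coord.
Qed.

Lemma leb_rV_cube d (M : R) :
  (leb_rV R d [set x | forall i, (- M <= x ord0 i <= M)%R] < +oo)%E.
Proof.
elim: d => [|d IH].
  by rewrite /= diracE; case: (_ \in _) => /=; rewrite ltry.
pose A := [set x : 'rV[R]_d | forall i, (- M <= x ord0 i <= M)%R].
rewrite /= /leb_rV_step /pushforward.
rewrite (_ : _ @^-1` _ = `[- M, M] `*` A); last first.
  apply/seteqP; split=> -[a v] /=.
    move=> avM; split.
      by have := avM ord0; rewrite mxE unlift_none/= in_itv.
    by move=> i; have := avM (lift ord0 i); rewrite mxE liftK.
  move=> [+ vM] i; rewrite in_itv/= => aM; rewrite mxE.
  by case: unliftP => [j _|_] //=.
rewrite product_measure1E//=; last exact: measurable_cube.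
rewrite lebesgue_measure_itv/=; case: ifP => [MM|_]; last by rewrite mul0e ltry.
rewrite -EFinD; apply: lte_mul_pinfty => //; rewrite lee_fin.
by move: MM; rewrite lte_fin; lra.
Qed.

Lemma leb_rV_bounded d (A : set 'rV[R]_d) : measurable A -> bounded_set A ->
  (leb_rV R d A < +oo)%E.
Proof.
move=> mA /bounded_leb_rV[M AM]; apply: le_lt_trans (leb_rV_cube d M).
apply: le_measure; rewrite ?inE//; first exact: measurable_cube.
by move=> x Ax i; rewrite -ler_norml; exact: AM.
Qed.

Lemma product_measure12E d1 d2 (T1 : measurableType d1) (T2 : measurableType d2)
    (m1 : {sigma_finite_measure set T1 -> \bar R})
    (m2 : {sigma_finite_measure set T2 -> \bar R}) (A : set (T1 * T2)) :
  measurable A -> (m1 \x m2)%E A = (m1 \x^ m2)%E A.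
Proof.
by move=> mA; apply: product_measure_unique => //= B C mB mC; rewrite product_measure2E.
Qed.

(** By Fubini along the axis of the graph: each line in that direction meets
    the graph at one point. *)
Lemma leb_rV_graph d (i : 'I_d) (A : set 'rV[R]_d) : measurable A ->
  (forall x y, A x -> A y -> (forall j, j != i -> x ord0 j = y ord0 j) ->
     x ord0 i = y ord0 i) ->
  leb_rV R d A = 0%E.
Proof.
elim: d i A => [[]//|d IH] i A mA gA.
rewrite /= /leb_rV_step /pushforward.
set B := _ @^-1` _.
have mB : measurable B.
  by rewrite -[B]setTI; apply: measurable_cons_rV.
case: (unliftP ord0 i) => [j ij|i0].
  (* the slices at a fixed first coordinate are graphs in lower dimension *)
  rewrite /product_measure1; apply: integral0_eq => a _ /=.
  apply: (IH j); first exact: measurable_xsection.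
  move=> x y; rewrite /xsection/= !inE /B/= => Ax Ay xy.
  have := gA _ _ Ax Ay; rewrite /cons_rV !mxE ij liftK/=; apply => k ki.
  rewrite !mxE; case: unliftP => //= l kl.
  by apply: xy; apply: contra_neq ki => <-.
(* along the first axis, slice by the other coordinates instead: the slices
   have at most one point *)
rewrite product_measure12E// /product_measure2; apply: integral0_eq => v _ /=.
have ss a b : ysection B v a -> ysection B v b -> a = b.
  rewrite /ysection/= !inE /B/= => Aa Ab.
  have := gA _ _ Aa Ab; rewrite /cons_rV !mxE i0 unlift_none/=; apply => k ki.
  rewrite !mxE; case: unliftP => //= k0.
  by rewrite k0 eqxx in ki.
have [->|/set0P[a Ba]] := eqVneq (ysection B v) set0; first by rewrite measure0.
rewrite (_ : ysection B v = [set a]) ?lebesgue_measure_set1//.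
by apply/seteqP; split => b /= => [Bb|->//]; exact: ss.
Qed.

(** Negligibility is a local property on a compact set, which is covered by
    finitely many of the given neighbourhoods. *)
Lemma negligible_cover d (S : set 'rV[R]_d) (f : 'rV[R]_d -> set 'rV[R]_d) :
  compact S -> (forall x, S x -> open (f x) /\ f x x) ->
  (forall x, S x -> (leb_rV R d).-negligible (S `&` f x)) ->
  (leb_rV R d).-negligible S.
Proof.
move=> cS of_ nf.
move: cS; rewrite compact_cover => /(_ _ S f).
case=> [x /of_[]//|x Sx|D DS SD].
  by exists x => //; have [] := of_ x Sx.
pose r := finmap.enum_fset D.
pose F (k : nat) : set 'rV[R]_d :=
  if (k < size r)%N then S `&` f (nth 0 r k) else set0.
apply: (@negligibleS _ _ _ _ (\bigcup_k F k)).
  move=> x Sx; have [y yD fyx] := SD x Sx.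
  have yr : y \in r by [].
  by exists (index y r) => //; rewrite /F index_mem yr nth_index.
apply: negligible_bigcup => k; rewrite /F; case: ifP => kD; last exact: negligible_set0.
by apply: nf; have /DS := mem_nth 0 kD; rewrite inE.
Qed.

(** Near each of its points the boundary lies in the graph of a continuous
    function of the other coordinates: strictly above the graph a point is
    interior to [Om], strictly below it is away from the closure. *)
Lemma C2_boundary_negligible d (Om : set 'rV[R]_d) : open Om -> bounded_set Om ->
  C2_boundary Om -> (leb_rV R d).-negligible (closure Om `\` Om).
Proof.
move=> oOm bOm C2Om; set S := closure Om `\` Om.
have SE : S = closure Om `\` interior Om by rewrite /S [interior Om](interior_id Om).1.
have cS : compact S.
  apply: bounded_closed_compact; last first.
    by apply: closedI; [exact: closed_closure|exact: open_closedC].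
  have [M [_ OmM]] := bOm.
  have clM : closure Om `<=` [set x : 'rV[R]_d | `|x| <= M + 1].
    have cM : closed [set x : 'rV[R]_d | `|x| <= M + 1].
      apply: (@closed_comp _ _ (fun x : 'rV[R]_d => `|x|) [set z | z <= M + 1]).
        by move=> x _; exact: norm_continuous.
      exact: closed_le.
    rewrite [X in _ `<=` X]((closure_id _).1 cM); apply: closureS => x Omx.
    by apply: OmM => //; rewrite ltrDl.
  exists (M + 1); split; first exact: num_real.
  by move=> N MN x [/clM/= xM _]; rewrite (le_trans xM)// ltW.
have H x0 : {f : set 'rV[R]_d | S x0 -> [/\ open f, f x0 &
    (leb_rV R d).-negligible (S `&` f)]}.
  apply: cid; have [Sx0|nS] := pselect (S x0); last by exists set0.
  have := C2Om x0; rewrite -SE => /(_ Sx0)[r [i [b [g [r0 [[cg _ _] _] gi gOm]]]]].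
  have e0 : 0 < r / d.+1%:R by rewrite divr_gt0.
  exists (ball x0 (r / d.+1%:R)) => _; split.
  - exact: ball_open.
  - exact: ballxx.
  pose h (x : 'rV[R]_d) := g x - (-1) ^+ b * x ord0 i.
  have ch : continuous h.
    move=> x; apply: (cvgB (cg x)); apply: cvgMl_tmp; exact: coord_continuous.
  have oh : open (h @^-1` [set z | 0 < z]).
    by apply: open_comp; [move=> y _; exact: ch|exact: open_gt].
  pose G := [set x : 'rV[R]_d | h x = 0].
  have mG : measurable G.
    apply: closed_measurable_rV.
    apply: (@closed_comp _ _ h [set 0]); last exact: closed_eq.
    by move=> x _; exact: ch.
  apply: (@negligibleS _ _ _ _ G).
    move=> x [[clx nOmx] x0x]; have xr := eucl_ball r0 x0x.
    have := gOm x xr => Omx.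
    apply/eqP; rewrite eq_le; apply/andP; split; rewrite leNgt; apply/negP => hx.
      have : nbhs x (h @^-1` [set z | 0 < z] `&` ball x0 (r / d.+1%:R)).
        apply: filterI.
          by apply: open_nbhs_nbhs; split.
        by apply: open_nbhs_nbhs; split => //; exact: ball_open.
      move=> /clx[y [Omy [/= hy x0y]]]; have yr := eucl_ball r0 x0y.
      by move: hy; rewrite /h subr_gt0 ltNge ltW//; apply/(gOm y yr).
    by apply: nOmx; apply/Omx; move: hx; rewrite /h subr_lt0.
  apply/negligibleP => //; apply: (leb_rV_graph (i := i)) => // x y Gx Gy xy.
  have : (-1) ^+ b * x ord0 i = (-1) ^+ b * y ord0 i.
    move/eqP: Gx; move/eqP: Gy; rewrite !subr_eq0 => /eqP <- /eqP <-.
    exact: gi.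
  by apply: mulfI; rewrite signr_eq0.
apply: (negligible_cover (f := fun x => sval (H x))) => // x Sx;
  by case: (H x) => f /= /(_ Sx)[].
Qed.

End lebesgue_rV.
(** * Weighted quadratic forms *)

Section tonelli_rectangle.
Context d1 d2 (T1 : measurableType d1) (T2 : measurableType d2) (R : realType).
Context (m1 : {sigma_finite_measure set T1 -> \bar R})
  (m2 : {sigma_finite_measure set T2 -> \bar R}).
Local Open Scope ereal_scope.
Context (A : set T1) (B : set T2) (mA : measurable A) (mB : measurable B)
  (f : T1 * T2 -> \bar R).
Hypotheses (mf : measurable_fun setT f) (f0 : forall z, 0 <= f z).

Let g := f \_ (A `*` B).

Let mg : measurable_fun setT g.
Proof.
apply/(measurable_restrictT _ _).1; first exact: measurableX.
exact: measurable_funTS.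
Qed.

Let g0 z : 0 <= g z.
Proof. by rewrite /g /patch; case: ifP. Qed.

Let gE x y : g (x, y) = if x \in A then ((fun y => f (x, y)) \_ B) y else 0.
Proof.
rewrite /g /patch in_setX; case: (x \in A) => //=.
Qed.

Lemma tonelli_rect1 : \int[m1 \x m2]_(z in A `*` B) f z =
  \int[m1]_(x in A) \int[m2]_(y in B) f (x, y).
Proof.
rewrite integral_mkcond -/g [RHS]integral_mkcond (fubini_tonelli1 _ mg g0).
apply: eq_integral => x _; rewrite /fubini_F /patch -/g.
rewrite (eq_integral (fun y => g (x, y)))//; under eq_integral do rewrite gE.
by case: ifPn => xA; [rewrite -integral_mkcond|rewrite integral0].
Qed.

Lemma tonelli_rect2 : \int[m1 \x m2]_(z in A `*` B) f z =
  \int[m2]_(y in B) \int[m1]_(x in A) f (x, y).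
Proof.
rewrite integral_mkcond -/g [RHS]integral_mkcond (fubini_tonelli2 _ mg g0).
apply: eq_integral => y _; rewrite /fubini_G.
rewrite [LHS](eq_integral (fun x => g (x, y)))// [RHS]/patch.
case: ifPn => yB.
  rewrite [RHS]integral_mkcond; apply: eq_integral => x _.
  by rewrite gE [in LHS]/patch yB.
under eq_integral => x _ do rewrite gE /patch (negbTE yB) if_same.
by rewrite integral0.
Qed.

Lemma measurable_tonelli_rect1 :
  measurable_fun A (fun x => \int[m2]_(y in B) f (x, y)).
Proof.
have E : {in A, fubini_F m2 g =1 fun x => \int[m2]_(y in B) f (x, y)}.
  move=> x xA; rewrite /fubini_F [RHS]integral_mkcond.
  by apply: eq_integral => y _; rewrite gE xA.
apply: (eq_measurable_fun _ E); apply: measurable_funTS.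
exact: measurable_fun_fubini_tonelli_F.
Qed.

Lemma measurable_tonelli_rect2 :
  measurable_fun B (fun y => \int[m1]_(x in A) f (x, y)).
Proof.
have E : {in B, fubini_G m1 g =1 fun y => \int[m1]_(x in A) f (x, y)}.
  move=> y yB; rewrite /fubini_G [RHS]integral_mkcond.
  by apply: eq_integral => x _; rewrite gE [in LHS]/patch yB.
apply: (eq_measurable_fun _ E); apply: measurable_funTS.
exact: measurable_fun_fubini_tonelli_G.
Qed.

End tonelli_rectangle.

Section product_sigma_finite.
Context d1 d2 (T1 : measurableType d1) (T2 : measurableType d2) (R : realType).
Context (m1 : {sigma_finite_measure set T1 -> \bar R})
  (m2 : {sigma_finite_measure set T2 -> \bar R}).

Lemma product_sigma_finite : sigma_finite setT (m1 \x m2)%E.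
Proof.
have /sigma_finiteP[F [TF ndF Foo]] := sigma_finiteT m1.
have /sigma_finiteP[G [TG ndG Goo]] := sigma_finiteT m2.
exists (fun n => F n `*` G n).
  apply/esym; rewrite -subTset => -[x y] _.
  have [i _ Fx] : (\bigcup_i F i) x by rewrite -TF.
  have [j _ Gy] : (\bigcup_i G i) y by rewrite -TG.
  exists (maxn i j) => //; split => /=.
  - by move: x Fx; exact/subsetPset/ndF/leq_maxl.
  - by move: y Gy; exact/subsetPset/ndG/leq_maxr.
move=> i; have [mF Fi] := Foo i; have [mG Gi] := Goo i; split.
  exact: measurableX.
by rewrite product_measure1E// lte_mul_pinfty// ge0_fin_numE.
Qed.

(** Packed as a sigma-finite measure, the product can itself be a factor: the
    energies involve the exterior variable besides a pair of points. *)
Definition sigma_finite_product :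
    {sigma_finite_measure set (T1 * T2)%type -> \bar R} :=
  HB.pack (m1 \x m2)%E
    (Measure_isSigmaFinite.Build _ _ _ (m1 \x m2)%E product_sigma_finite).

End product_sigma_finite.

Section ae_product.
Context d1 d2 (T1 : measurableType d1) (T2 : measurableType d2) (R : realType).
Context (m1 : {sigma_finite_measure set T1 -> \bar R})
  (m2 : {sigma_finite_measure set T2 -> \bar R}).

Lemma ae_product1 (P : T1 -> Prop) : {ae m1, forall x, P x} ->
  {ae (m1 \x m2)%E, forall z, P z.1}.
Proof.
move=> [N [mN N0 PN]]; exists (N `*` setT); split; first exact: measurableX.
  by rewrite product_measure1E// [X in (X * _)%E]N0 mul0e.
by move=> [x y] /= nP; split => //; exact: PN.
Qed.

Lemma ae_product2 (P : T2 -> Prop) : {ae m2, forall y, P y} ->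
  {ae (m1 \x m2)%E, forall z, P z.2}.
Proof.
move=> [N [mN N0 PN]]; exists (setT `*` N); split; first exact: measurableX.
  by rewrite product_measure1E// [X in (_ * X)%E]N0 mule0.
by move=> [x y] /= nP; split => //; exact: PN.
Qed.

End ae_product.

Section ae_measurable_theory.
Context d (T : measurableType d) (R : realType).
Implicit Types (D : set T) (f g : T -> R).

Lemma measurable_ae_measurable (mu : {measure set T -> \bar R}) D f :
  measurable_fun setT f -> ae_measurable mu D f.
Proof. by move=> mf; exists f => //; apply: aeW. Qed.

Lemma ae_measurable_eq (mu : {measure set T -> \bar R}) D f f' :
  {ae mu, forall x, D x -> f x = f' x} ->
  ae_measurable mu D f -> ae_measurable mu D f'.
Proof.
move=> ff' [g mg fg]; exists g => //.
by apply: filterS2 ff' fg => x + + Dx => /(_ Dx) <- /(_ Dx).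
Qed.

Lemma ae_measurableD (mu : {measure set T -> \bar R}) D a f g :
  ae_measurable mu D f -> ae_measurable mu D g ->
  ae_measurable mu D (fun x => a * f x + g x).
Proof.
move=> [f' mf' ff'] [g' mg' gg']; exists (fun x => a * f' x + g' x).
  by apply: measurable_funD => //; apply: measurable_funM.
by apply: filterS2 ff' gg' => x + + Dx => /(_ Dx) -> /(_ Dx) ->.
Qed.

Lemma ae_measurable_difference (mu : {sigma_finite_measure set T -> \bar R})
    (D : set (T * T)) E f : D `<=` E `*` E -> ae_measurable mu E f ->
  ae_measurable (mu \x mu)%E D (fun z => f z.1 - f z.2).
Proof.
move=> DE [g mg fg]; exists (fun z => g z.1 - g z.2).
  by apply: measurable_funB; exact: measurableT_comp.
apply: filterS2 (ae_product1 mu fg) (ae_product2 mu fg) => z /= f1 f2 /DE[E1 E2].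
by rewrite f1// f2.
Qed.

End ae_measurable_theory.

Section weighted_form.
Context d (T : measurableType d) (R : realType) (mu : {measure set T -> \bar R}).
Context (D : set T) (mD : measurable D) (K : T -> \bar R).
Hypotheses (mK : measurable_fun setT K) (K0 : forall z, (0 <= K z)%E).
Local Open Scope ereal_scope.
Implicit Types p q : T -> R.

Definition weighted_form p : \bar R := \int[mu]_(z in D) ((p z ^+ 2)%:E * K z).

Lemma weighted_form_ge0 p : 0 <= weighted_form p.
Proof. by apply: integral_ge0 => z _; rewrite mule_ge0// lee_fin sqr_ge0. Qed.

Lemma weighted_form_ae p q : {ae mu, forall z, D z -> p z = q z} ->
  weighted_form p = weighted_form q.
Proof.
by move=> pq; apply: ae_eq_integralW; apply: filterS pq => z pq Dz; rewrite pq.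
Qed.

Let measurable_sqr p : measurable_fun setT p ->
  measurable_fun D (fun z => (p z ^+ 2)%:E * K z).
Proof.
move=> mp; apply: measurable_funTS; apply: emeasurable_funM => //.
by apply/measurable_EFinP; exact: measurable_funX.
Qed.

Let weighted_sqr_ge0 p z : D z -> 0 <= (p z ^+ 2)%:E * K z.
Proof. by move=> _; rewrite mule_ge0// lee_fin sqr_ge0. Qed.

Lemma weighted_formZ a p : ae_measurable mu D p ->
  weighted_form (fun z => a * p z)%R = (a ^+ 2)%:E * weighted_form p.
Proof.
move=> [p' mp' pp']; rewrite (weighted_form_ae pp').
rewrite (@weighted_form_ae (fun z => a * p z)%R (fun z => a * p' z)%R); last first.
  by apply: filterS pp' => z pp' Dz; rewrite pp'.
rewrite /weighted_form -(ge0_integralZl_EFin _ mD (@weighted_sqr_ge0 p')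
  (measurable_sqr mp')) ?sqr_ge0//.
by apply: eq_integral => z _; rewrite muleA -EFinM exprMn.
Qed.

Lemma weighted_formD a p q : ae_measurable mu D p -> ae_measurable mu D q ->
  weighted_form (fun z => a * p z + q z)%R <=
  (2 * a ^+ 2)%:E * weighted_form p + 2%:E * weighted_form q.
Proof.
move=> [p' mp' pp'] [q' mq' qq'].
rewrite (weighted_form_ae pp') (weighted_form_ae qq').
rewrite (@weighted_form_ae _ (fun z => a * p' z + q' z)%R); last first.
  by apply: filterS2 pp' qq' => z pp' qq' Dz; rewrite pp'// qq'.
have a0 : (0 <= 2 * a ^+ 2)%R by rewrite mulr_ge0// sqr_ge0.
have h r p0 : (0 <= r)%R -> forall z, D z -> 0 <= r%:E * ((p0 z ^+ 2)%:E * K z).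
  by move=> r0 z Dz; rewrite mule_ge0// weighted_sqr_ge0.
have mh r p0 : measurable_fun setT p0 ->
    measurable_fun D (fun z => r%:E * ((p0 z ^+ 2)%:E * K z)).
  by move=> mp0; apply: measurable_funeM; exact: measurable_sqr.
rewrite /weighted_form.
rewrite -(ge0_integralZl_EFin _ mD (@weighted_sqr_ge0 p') (measurable_sqr mp'))//.
rewrite -(ge0_integralZl_EFin _ mD (@weighted_sqr_ge0 q') (measurable_sqr mq'))//.
rewrite -(ge0_integralD _ mD (h _ p' a0) (mh _ _ mp') (h 2%R q' _) (mh _ _ mq'))//.
apply: ge0_le_ae_integral; first exact: weighted_sqr_ge0.
  by move=> z Dz; rewrite adde_ge0// h.
apply: aeW => z _; rewrite !muleA -!EFinM -ge0_muleDl ?lee_fin; last 2 first.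
- by rewrite mulr_ge0// sqr_ge0.
- by rewrite mulr_ge0// sqr_ge0.
rewrite lee_wpmul2r// -EFinD lee_fin -subr_ge0.
have -> : (2 * a ^+ 2 * p' z ^+ 2 + 2 * q' z ^+ 2 - (a * p' z + q' z) ^+ 2 =
  (a * p' z - q' z) ^+ 2)%R by ring.
exact: sqr_ge0.
Qed.

Lemma weighted_form_lty a p q : ae_measurable mu D p -> ae_measurable mu D q ->
  weighted_form p < +oo -> weighted_form q < +oo ->
  weighted_form (fun z => a * p z + q z)%R < +oo.
Proof.
move=> mp mq pf qf; apply: le_lt_trans (weighted_formD a mp mq) _.
have a0 : 0 <= (2 * a ^+ 2)%:E by rewrite lee_fin mulr_ge0// sqr_ge0.
by apply: lte_add_pinfty; apply: lte_mul_pinfty.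
Qed.

(** Where the weight is infinite, finiteness of the quadratic forms forces the
    functions to vanish, so that the polarization identity makes sense almost
    everywhere. *)
Lemma weighted_form_polarization p q :
  ae_measurable mu D p -> ae_measurable mu D q ->
  weighted_form p < +oo -> weighted_form q < +oo ->
  fine (\int[mu]_(z in D) ((p z * q z)%:E * K z)) =
  (4^-1 * (fine (weighted_form (fun z => 1 * p z + q z)%R) -
           fine (weighted_form (fun z => -1 * q z + p z)%R)))%R.
Proof.
move=> mp mq pf qf.
have sf := weighted_form_lty 1 mp mq pf qf.
have df := weighted_form_lty (-1) mq mp qf pf.
have [p' mp' pp'] := mp; have [q' mq' qq'] := mq.
pose s z := (1 * p' z + q' z)%R; pose t z := (-1 * q' z + p' z)%R.
have ms : measurable_fun setT s by apply: measurable_funD => //; exact: measurable_funM.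
have mt : measurable_fun setT t by apply: measurable_funD => //; exact: measurable_funM.
have ps : weighted_form (fun z => 1 * p z + q z)%R = weighted_form s.
  by apply: weighted_form_ae; apply: filterS2 pp' qq' => z pp' qq' Dz;
    rewrite pp'// qq'.
have pt : weighted_form (fun z => -1 * q z + p z)%R = weighted_form t.
  by apply: weighted_form_ae; apply: filterS2 pp' qq' => z pp' qq' Dz;
    rewrite pp'// qq'.
rewrite ps pt; rewrite ps in sf; rewrite pt in df.
have is_ : mu.-integrable D (fun z => (s z ^+ 2)%:E * K z).
  apply/integrableP; split; first exact: measurable_sqr.
  by under eq_integral => z /[1!inE] zD do rewrite gee0_abs ?weighted_sqr_ge0//.
have it_ : mu.-integrable D (fun z => (t z ^+ 2)%:E * K z).
  apply/integrableP; split; first exact: measurable_sqr.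
  by under eq_integral => z /[1!inE] zD do rewrite gee0_abs ?weighted_sqr_ge0//.
rewrite -fineB; last 2 first.
- by rewrite ge0_fin_numE// weighted_form_ge0.
- by rewrite ge0_fin_numE// weighted_form_ge0.
rewrite /weighted_form -integralB// -[(4^-1)%R]/(fine (4^-1)%:E) -fineM//; last first.
  by rewrite integral_fune_fin_num//; exact: integrableB.
rewrite -integralZl//; last exact: integrableB.
congr fine; apply: ae_eq_integralW.
have pq : {ae mu, forall z, D z -> p z = p' z /\ q z = q' z}.
  by apply: filterS2 pp' qq' => z pz qz Dz; split; [exact: pz|exact: qz].
apply: filterS3 (integrable_ae mD is_) (integrable_ae mD it_) pq.
move=> z sz tz pqz Dz; have [-> ->] := pqz Dz.
have := sz Dz; have := tz Dz; case: (K z) (K0 z) => [k|_|//].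
  by move=> _ _ _; rewrite -!EFinM; congr EFin; rewrite /s /t; field.
have h (a : R) : (a ^+ 2)%:E * +oo \is a fin_num -> a = 0%R.
  have [->//|a0] := eqVneq a 0%R.
  by rewrite gt0_muley// lte_fin lt_neqAle sqr_ge0 eq_sym sqrf_eq0 a0.
move=> /h t0 /h s0; rewrite s0 t0 expr0n/= mul0e sube0 mule0.
have -> : p' z = 0%R by move: s0 t0; rewrite /s /t; lra.
by rewrite mul0r mul0e.
Qed.

End weighted_form.
(** * The energy identity *)

Section variance.
Context d (T : measurableType d) (R : realType) (mu : {measure set T -> \bar R}).
Context (D : set T) (mD : measurable D) (kappa v : T -> R).
Hypotheses (mkappa : measurable_fun setT kappa) (mv : measurable_fun setT v)
  (kappa0 : forall y, 0 <= kappa y).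
Hypotheses (i0 : mu.-integrable D (EFin \o kappa))
  (i1 : mu.-integrable D (EFin \o (fun y => v y * kappa y)))
  (i2 : mu.-integrable D (EFin \o (fun y => v y ^+ 2 * kappa y))).

Let N := \int[mu]_(y in D) kappa y.
Let B := \int[mu]_(y in D) (v y * kappa y).
Let A := \int[mu]_(y in D) (v y ^+ 2 * kappa y).

(** Both the inner and the outer integral of the variance are of this form, so
    that everything reduces to the three moments [N], [B] and [A]. *)
Lemma integral_quadratic (a b c : R) :
  (\int[mu]_(y in D) ((a * v y ^+ 2 + b * v y + c) * kappa y)%:E =
   (a * A + b * B + c * N)%:E)%E.
Proof.
have e2 : (A%:E = \int[mu]_(y in D) (v y ^+ 2 * kappa y)%:E)%E.
  by rewrite fineK//; exact: integrable_fin_num.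
have e1 : (B%:E = \int[mu]_(y in D) (v y * kappa y)%:E)%E.
  by rewrite fineK//; exact: integrable_fin_num.
have e0 : (N%:E = \int[mu]_(y in D) (kappa y)%:E)%E.
  by rewrite fineK//; exact: integrable_fin_num.
rewrite !EFinD !EFinM e2 e1 e0.
rewrite -(integralZl mD i2) -(integralZl mD i1) -(integralZl mD i0).
have j2 := integrableZl mD a i2; have j1 := integrableZl mD b i1.
have j0 := integrableZl mD c i0.
rewrite -(integralD mD j2 j1) -(integralD mD _ j0); last exact: integrableD.
apply: eq_integral => y _ /=.
by rewrite -!EFinM -!EFinD; congr EFin; ring.
Qed.

(** The second moment about [a] is the variance plus the squared distance from
    [a] to the mean, and the variance is half the mean of the squared differences
    of two independent values. When the mass [N] vanishes, so does every
    term. *)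
Lemma variance_identity (a : R) :
  (\int[mu]_(y in D) ((a - v y) ^+ 2 * kappa y)%:E =
   (2^-1)%:E * (\int[mu]_(x in D) \int[mu]_(y in D)
      (((v x - v y) ^+ 2)%:E *
       ((kappa x * kappa y)%:E / \int[mu]_(y in D) (kappa y)%:E)))
   + (N * (a - B / N) ^+ 2)%:E)%E.
Proof.
have e0 : (\int[mu]_(y in D) (kappa y)%:E = N%:E)%E.
  by rewrite fineK//; exact: integrable_fin_num.
rewrite e0.
have sq b : (\int[mu]_(y in D) ((b - v y) ^+ 2 * kappa y)%:E =
    (A - 2 * b * B + b ^+ 2 * N)%:E)%E.
  rewrite -mulNr -[A]mul1r -integral_quadratic.
  by apply: eq_integral => y _; congr EFin; ring.
have N0 : 0 <= N by apply: Rintegral_ge0 => y _; exact: kappa0.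
move: N0; rewrite le_eqVlt => /predU1P[N0|N0].
  have k0 : {ae mu, forall y, D y -> kappa y = 0}.
    have := (ae_eq_integral_abs mu mD (measurable_int mu i0)).1.
    have -> : (\int[mu]_(x in D) `|(EFin \o kappa) x| = 0)%E.
      by rewrite -[RHS]/(0%:E) N0 -e0; apply: eq_integral => y _;
        rewrite gee0_abs// lee_fin.
    by move=> /(_ erefl); apply: filterS => y k0 Dy; have [] := k0 Dy.
  rewrite -N0 mul0r adde0.
  rewrite (@ae_eq_integralW _ _ _ _ _ _ (cst 0%E)); last first.
    by apply: filterS k0 => y k0 Dy /=; rewrite k0// mulr0.
  rewrite integral0 (@ae_eq_integralW _ _ _ _ _ _ (cst 0%E)); last first.
    apply: filterS k0 => x k0 Dx; apply: integral0_eq => y Dy.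
    by rewrite k0// mul0r mul0e mule0.
  by rewrite integral0 mule0.
rewrite inver gt_eqF// sq.
have inner x : (\int[mu]_(y in D)
    (((v x - v y) ^+ 2)%:E * ((kappa x * kappa y)%:E * N^-1%:E)) =
    ((v x ^+ 2 + (- (2 * B / N)) * v x + A / N) * kappa x)%:E)%E.
  transitivity ((kappa x / N)%:E * \int[mu]_(y in D) ((v x - v y) ^+ 2 * kappa y)%:E)%E.
    rewrite -ge0_integralZl_EFin//.
    - by apply: eq_integral => y _; rewrite -!EFinM; congr EFin; ring.
    - by move=> y _; rewrite lee_fin mulr_ge0// sqr_ge0.
    - apply: measurable_funTS; apply/measurable_EFinP; apply: measurable_funM => //.
      by apply: measurable_funX; apply: measurable_funB.
    - by rewrite divr_ge0// ltW.
  by rewrite sq -EFinM; congr EFin; field; rewrite gt_eqF.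
under [X in (_ = _ * X + _)%E]eq_integral do rewrite inner -[v _ ^+ 2]mul1r.
rewrite integral_quadratic -EFinM -EFinD; congr EFin.
by field; rewrite gt_eqF.
Qed.

End variance.

Lemma measurable_inve (R : realType) d (T : measurableType d) (f : T -> \bar R) :
  measurable_fun setT f -> (forall x, 0 <= f x)%E ->
  measurable_fun setT (fun x => (f x)^-1%E).
Proof.
move=> mf f0.
rewrite (_ : (fun x => _) = fun x =>
    if f x == 0%E then +oo%E else ((fine (f x)) `^ (-1))%:E); last first.
  apply/funext => x; have := f0 x; case: (f x) => [r|_|//].
    rewrite lee_fin inver eqe => r0; case: ifPn => // rn.
    by rewrite /= powR_inv1.
  by rewrite invey /= powR0// oppr_eq0 oner_eq0.
apply: measurable_fun_ifT => //.
  by apply: measurable_fun_eqe => //.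
apply/measurable_EFinP; apply: (measurableT_comp (measurable_powR _)).
exact: measurableT_comp.
Qed.
(** The final computation of the energy identity, in which any of the three
    terms may be infinite. *)
Lemma energy_arith (R : realFieldType) (c : R) (I H X : \bar R) : 0 < c ->
  (0 <= I)%E -> (0 <= H)%E -> (0 <= X)%E ->
  ((c / 2)%:E * (I + ((2^-1)%:E * H + X) + ((2^-1)%:E * H + X)) =
   (2^-1)%:E * (c%:E * (I + H)) + c%:E * X)%E.
Proof.
move=> c0; have c2 : 0 < c / 2 by rewrite divr_gt0.
have h2 : (0 < 2^-1 :> R) by rewrite invr_gt0.
have y a : 0 < a -> (a%:E * +oo = +oo :> \bar R)%E.
  by move=> a0; rewrite gt0_muley// lte_fin.
have [yc yd yh] : [/\ c%:E * +oo = +oo, (c / 2)%:E * +oo = +oo &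
   (2^-1)%:E * +oo = +oo :> \bar R]%E by split; exact: y.
have ry (r : R) : (r%:E + +oo = +oo :> \bar R)%E by [].
have yr (r : R) : (+oo + r%:E = +oo :> \bar R)%E by [].
have yy : (+oo + +oo = +oo :> \bar R)%E by [].
case: I => [i| |//]; case: H => [h| |//]; case: X => [x| |//] _ _ _;
  do 4! rewrite -?EFinM ?(yc, yd, yh, ry, yr, yy) //.
by congr EFin; field.
Qed.

Section energy.
Context (R : realType) (d : nat) (Om : set 'rV[R]_d) (s : R).
Hypotheses (mOm : measurable Om) (Om_fin : (leb_rV R d Om < +oo)%E)
  (bOm : (leb_rV R d).-negligible (closure Om `\` Om)) (s01 : 0 < s < 1).
Local Notation mu := (leb_rV R d).
Local Notation mu2 := (leb_rV R d \x leb_rV R d)%E.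
Local Notation k := (@frac_kernel R d s).
Implicit Types v phi : 'rV[R]_d -> R.

Let mm := sigma_finite_product mu mu.

Let s_gt0 : 0 < s. Proof. by case/andP: s01. Qed.
Let s1_ge0 : 0 <= 1 - s. Proof. by case/andP: s01 => _ ?; rewrite subr_ge0 ltW. Qed.

Let mOc : measurable (~` Om). Proof. exact: measurableC. Qed.

Let N (z : 'rV[R]_d) : \bar R := (\int[mu]_(eta in Om) (k z eta)%:E)%E.

Let N_ge0 z : (0 <= N z)%E.
Proof. by apply: integral_ge0 => y _; rewrite lee_fin frac_kernel_ge0. Qed.

Let mkE : measurable_fun setT (fun z : 'rV[R]_d * 'rV[R]_d => (k z.1 z.2)%:E).
Proof. by apply/measurable_EFinP; exact: measurable_frac_kernel. Qed.

Let mN : measurable_fun setT N.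
Proof.
apply: (measurable_tonelli_rect1 mu measurableT mOm mkE) => z.
by rewrite lee_fin frac_kernel_ge0.
Qed.

Lemma measurable_kernel_section z : measurable_fun setT (k z).
Proof.
apply: (measurableT_comp (measurable_frac_kernel s)
  (g := fun y : 'rV[R]_d => (z, y))).
exact: measurable_pair1.
Qed.

(** [v] and [v ^+ 2] are integrable against the kernel seen from an exterior
    point, since the kernel is bounded there and [Om] has finite measure. *)
Lemma exterior_integrable v z : measurable_fun setT v ->
  (\int[mu]_(x in Om) (v x ^+ 2)%:E < +oo)%E -> ~ closure Om z ->
  [/\ mu.-integrable Om (EFin \o k z),
      mu.-integrable Om (EFin \o (fun y => v y * k z y)) &
      mu.-integrable Om (EFin \o (fun y => v y ^+ 2 * k z y))].
Proof.
move=> mv v2 /(frac_kernel_bounded s_gt0)[M kM].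
have mk := measurable_kernel_section z.
have M0 y : Om y -> 0 <= M by move=> /kM; apply: le_trans; exact: frac_kernel_ge0.
have c1 : mu.-integrable Om (EFin \o cst M).
  apply/integrableP; split.
    by apply: measurable_funTS; apply/measurable_EFinP; exact: measurable_cst.
  by rewrite (eq_integral (cst `|M|%:E))// integral_cst// lte_mul_pinfty.
have c2 : mu.-integrable Om (EFin \o (fun y => v y ^+ 2)).
  apply/integrableP; split.
    by apply: measurable_funTS; apply/measurable_EFinP; exact: measurable_funX.
  by under eq_integral do rewrite /= ger0_norm ?sqr_ge0//.
have c3 : mu.-integrable Om (EFin \o (fun y => M * v y ^+ 2)).
  by have := integrableZl mOm M c2; apply: eq_integrable.
have c4 : mu.-integrable Om (EFin \o (fun y => M * v y ^+ 2 + M)).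
  by have := integrableD mOm c3 c1; apply: eq_integrable.
have me (f : 'rV[R]_d -> R) : measurable_fun setT f -> measurable_fun Om (EFin \o f).
  by move=> mf; apply: measurable_funTS; exact/measurable_EFinP.
split.
- apply: (le_integrable mOm (me _ mk) _ c1) => y Omy.
  rewrite /= lee_fin !ger0_norm ?frac_kernel_ge0 ?(M0 _ Omy)//.
  exact: kM.
- apply: (le_integrable mOm (me _ (measurable_funM mv mk)) _ c4) => y Omy.
  have My := M0 _ Omy; have ky := kM _ Omy.
  have M4 : 0 <= M * v y ^+ 2 + M by rewrite addr_ge0// mulr_ge0// sqr_ge0.
  rewrite /= lee_fin normrM [`|k _ _|]ger0_norm ?frac_kernel_ge0//.
  rewrite [leRHS]ger0_norm//.
  apply: (@le_trans _ _ (`|v y| * M)); first by rewrite ler_wpM2l.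
  rewrite mulrC -[X in _ + X]mulr1 -mulrDr ler_wpM2l//.
  (* [|v| <= v ^+ 2 + 1], because the discriminant is negative *)
  rewrite -[v y ^+ 2]ger0_norm ?sqr_ge0// normrX.
  rewrite -subr_ge0 (_ : _ - _ = (`|v y| - 2^-1) ^+ 2 + 3 / 4); last by field.
  by rewrite addr_ge0 ?sqr_ge0// divr_ge0.
- apply: (le_integrable mOm (me _ (measurable_funM (measurable_funX _ mv) mk)) _ c3).
  move=> y Omy; have My := M0 _ Omy; have ky := kM _ Omy.
  rewrite /= lee_fin !normrM [`|k _ _|]ger0_norm ?frac_kernel_ge0//.
  by rewrite mulrC ler_wpM2r// ger0_norm.
Qed.

Let G (p : ('rV[R]_d * 'rV[R]_d) * 'rV[R]_d) : \bar R :=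
  ((k p.1.1 p.2 * k p.1.2 p.2)%:E / N p.2)%E.

Let mG : measurable_fun setT G.
Proof.
apply: emeasurable_funM.
  apply/measurable_EFinP; apply: measurable_funM.
    apply: (measurableT_comp (measurable_frac_kernel s)
      (g := fun p : ('rV[R]_d * 'rV[R]_d) * 'rV[R]_d => (p.1.1, p.2))).
    by apply: measurable_fun_pair => //; exact: measurableT_comp.
  apply: (measurableT_comp (measurable_frac_kernel s)
    (g := fun p : ('rV[R]_d * 'rV[R]_d) * 'rV[R]_d => (p.1.2, p.2))).
  by apply: measurable_fun_pair => //; exact: measurableT_comp.
apply: (measurableT_comp (measurable_inve mN N_ge0)
  (g := fun p : ('rV[R]_d * 'rV[R]_d) * 'rV[R]_d => p.2)).
exact: measurable_snd.
Qed.

Let G_ge0 p : (0 <= G p)%E.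
Proof. by rewrite mule_ge0 ?inve_ge0// lee_fin mulr_ge0 ?frac_kernel_ge0. Qed.

Lemma regional_kernelE x y : regional_kernel Om s x y =
  ((1 - s)%:E * ((k x y)%:E + \int[mu]_(z in ~` Om) G ((x, y), z)))%E.
Proof. by []. Qed.

Lemma measurable_regional_kernel : measurable_fun setT
  (fun z : 'rV[R]_d * 'rV[R]_d => regional_kernel Om s z.1 z.2).
Proof.
apply: measurable_funeM; apply: emeasurable_funD => //.
have := measurable_tonelli_rect1 mu measurableT mOc mG G_ge0.
by apply: eq_measurable_fun => -[x y] _.
Qed.

Lemma regional_kernel_ge0 x y : (0 <= regional_kernel Om s x y)%E.
Proof.
rewrite mule_ge0 ?lee_fin// adde_ge0 ?lee_fin ?frac_kernel_ge0//.
by apply: integral_ge0 => z _; exact: (G_ge0 (x, y, z)).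
Qed.

(** Up to the factor [1 - s], the amount by which the Neumann energy of [v]
    exceeds the least one compatible with its values in [Om]. *)
Definition exterior_excess v : \bar R :=
  (\int[mu]_(z in ~` Om)
     (\int[mu]_(y in Om) k z y * (v z - neumann_average Om s v z) ^+ 2)%:E)%E.

Lemma ae_exterior (P : 'rV[R]_d -> Prop) : (forall z, ~ closure Om z -> P z) ->
  {ae mu, forall z, (~` Om) z -> P z}.
Proof.
move=> eP; apply: negligibleS bOm => z /= /not_implyP[nOmz nPz]; split => //.
by apply: contrapT => /eP.
Qed.

Lemma measurable_neumann_average v : measurable_fun setT v ->
  measurable_fun setT (neumann_average Om s v).
Proof.
move=> mv; pose f (p : 'rV[R]_d * 'rV[R]_d) := (v p.2 * k p.1 p.2)%:E.
have mf : measurable_fun setT f.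
  apply/measurable_EFinP; apply: measurable_funM; last exact: measurable_frac_kernel.
  exact: (measurableT_comp mv).
apply: measurable_funM.
  apply: measurableT_comp => //.
  rewrite (_ : (fun x => _) = fun z =>
    (\int[mu]_(y in Om) f^\+ (z, y) - \int[mu]_(y in Om) f^\- (z, y))%E).
    apply: emeasurable_funB.
      apply: (measurable_tonelli_rect1 mu measurableT mOm) => //.
      exact: measurable_funepos.
    apply: (measurable_tonelli_rect1 mu measurableT mOm) => //.
    exact: measurable_funeneg.
  apply/funext => z; rewrite integralE.
  by congr (_ - _)%E; apply: eq_integral => y _; rewrite ?funeposE ?funenegE.
rewrite (_ : (fun x => _) = fun z => (fine (N z)) `^ (-1)); last first.
  apply/funext => z; rewrite powR_inv1// fine_ge0//; exact: N_ge0.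
apply: (measurableT_comp (measurable_powR _)).
exact: measurableT_comp.
Qed.

(** The Neumann energy consists of the interactions within [Om] and twice those
    between [Om] and the exterior. By Tonelli the latter are integrated over the
    exterior point last, where [variance_identity] turns them into the nonlocal
    part of the regional kernel plus the excess. *)
Lemma energy_identity_measurable v : measurable_fun setT v ->
  (\int[mu]_(x in Om) (v x ^+ 2)%:E < +oo)%E ->
  neumann_energy Om s v =
  ((2^-1)%:E * regional_energy Om s v + (1 - s)%:E * exterior_excess v)%E.
Proof.
move=> mv v2.
pose D (z : 'rV[R]_d * 'rV[R]_d) := (v z.1 - v z.2) ^+ 2.
have mD : measurable_fun setT D.
  by apply: measurable_funX; apply: measurable_funB; exact: measurableT_comp.
pose f z := (D z * k z.1 z.2)%:E.
have mf : measurable_fun setT f.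
  by apply/measurable_EFinP; apply: measurable_funM => //; exact: measurable_frac_kernel.
have f0 z : (0 <= f z)%E by rewrite lee_fin mulr_ge0 ?sqr_ge0 ?frac_kernel_ge0.
pose I := (\int[mu2]_(z in Om `*` Om) f z)%E.
pose J := (\int[mu]_(z in ~` Om) \int[mu]_(y in Om) f (z, y))%E.
pose h z := (\int[mu]_(x in Om) \int[mu]_(y in Om) ((D (x, y))%:E * G ((x, y), z)))%E.
have QE : Q_set Om = (Om `*` Om `|` Om `*` ~` Om) `|` ~` Om `*` Om.
  apply/seteqP; split=> -[x y]; rewrite /Q_set/=.
    have [?|?] := pselect (Om x); have [?|?] := pselect (Om y); tauto.
  tauto.
have EN : neumann_energy Om s v = (((1 - s) / 2)%:E * (I + J + J))%E.
  rewrite /neumann_energy; congr (_ * _)%E.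
  rewrite QE ge0_integral_setU//=; last 5 first.
  - by apply: measurableU; exact: measurableX.
  - exact: measurableX.
  - exact: measurable_funTS.
  - by move=> z _; exact: f0.
  - by apply/disj_setPS => -[x y] [/= [[? ?]|[? ?]] [? ?]].
  rewrite ge0_integral_setU//=; last 5 first.
  - exact: measurableX.
  - exact: measurableX.
  - exact: measurable_funTS.
  - by move=> z _; exact: f0.
  - by apply/disj_setPS => -[x y] [/= [? ?] [? ?]].
  rewrite -/I; congr (_ + _ + _)%E.
    rewrite (tonelli_rect2 mu mu mOm mOc mf f0).
    apply: eq_integral => z _; apply: eq_integral => y _.
    by rewrite /f /D/= frac_kernelC -sqrrN opprB.
  exact: (tonelli_rect1 mu mu mOc mOm mf f0).
have mH : measurable_fun setT
    (fun p : ('rV[R]_d * 'rV[R]_d) * 'rV[R]_d => (D p.1)%:E * G p)%E.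
  apply: emeasurable_funM => //; apply/measurable_EFinP.
  exact: (measurableT_comp mD).
have H0 p : (0 <= (D p.1)%:E * G p)%E by rewrite mule_ge0// lee_fin sqr_ge0.
have mOO : measurable (Om `*` Om) by exact: measurableX.
have hE z : h z = (\int[mu2]_(p in Om `*` Om) ((D p)%:E * G (p, z)))%E.
  apply/esym; apply: (tonelli_rect1 mu mu mOm mOm
    (f := fun p => ((D p)%:E * G (p, z))%E)) => [|p].
    apply: (measurableT_comp mH (g := fun p => (p, z))).
    exact: measurable_pair2.
  exact: (H0 (p, z)).
have mh : measurable_fun (~` Om) h.
  rewrite (funext hE).
  exact: (measurable_tonelli_rect2 mm mOO mOc mH H0).
have h0 z : (0 <= h z)%E.
  by apply: integral_ge0 => x _; apply: integral_ge0 => y _; exact: (H0 (x, y, z)).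
pose g (p : 'rV[R]_d * 'rV[R]_d) := (\int[mu]_(z in ~` Om) ((D p)%:E * G (p, z)))%E.
have g0 p : (0 <= g p)%E by apply: integral_ge0 => z _; exact: (H0 (p, z)).
have mg : measurable_fun (Om `*` Om) g.
  exact: (measurable_tonelli_rect1 mu mOO mOc mH H0).
have ER : regional_energy Om s v =
    ((1 - s)%:E * (I + \int[mu]_(z in ~` Om) h z))%E.
  transitivity (\int[mu2]_(p in Om `*` Om) ((1 - s)%:E * (f p + g p)))%E.
    apply: eq_integral => -[x y] _; rewrite regional_kernelE muleCA.
    apply: (f_equal2 mule); first by [].
    rewrite ge0_muleDr ?lee_fin ?frac_kernel_ge0//; last first.
      by apply: integral_ge0 => z _; exact: (G_ge0 (x, y, z)).
    apply: (f_equal2 adde); first by [].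
    apply/esym; apply: (ge0_integralZl_EFin mu mOc (f1 := fun z => G ((x, y), z))).
    - by move=> z _; exact: G_ge0.
    - apply: measurable_funTS; apply: (measurableT_comp mG (g := fun z => ((x, y), z))).
      exact: measurable_pair1.
    - exact: sqr_ge0.
  have mfg : measurable_fun (Om `*` Om) (fun p => f p + g p)%E.
    by apply: emeasurable_funD => //; exact: measurable_funTS.
  rewrite (ge0_integralZl_EFin mm mOO (fun p _ => adde_ge0 (f0 p) (g0 p)) mfg s1_ge0).
  apply: (f_equal2 mule); first by [].
  have mfI : measurable_fun (Om `*` Om) f by exact: measurable_funTS.
  rewrite (ge0_integralD mm mOO (fun p _ => f0 p) mfI (fun p _ => g0 p) mg).
  apply: (f_equal2 adde); first by [].
  apply: eq_trans (esym (tonelli_rect1 mm mu mOO mOc mH H0)) _.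
  apply: eq_trans (tonelli_rect2 mm mu mOO mOc mH H0) _.
  by apply: eq_integral => z _; rewrite hE.
have je z : ~ closure Om z -> (\int[mu]_(y in Om) f (z, y) = (2^-1)%:E * h z +
    (\int[mu]_(y in Om) k z y * (v z - neumann_average Om s v z) ^+ 2)%:E)%E.
  move=> zOm; have [i0 i1 i2] := exterior_integrable mv v2 zOm.
  have E := variance_identity mOm (measurable_kernel_section z) mv
    (fun y => frac_kernel_ge0 s z y) i0 i1 i2 (v z).
  transitivity (\int[mu]_(y in Om) ((v z - v y) ^+ 2 * k z y)%:E)%E.
    by apply: eq_integral.
  apply: (eq_trans E).
  rewrite /neumann_average.
  apply: (f_equal2 adde); last by [].
  apply: (f_equal2 mule); first by [].
  apply: eq_integral => x _; apply: eq_integral => y _.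
  by rewrite /G/= !(frac_kernelC _ _ z).
have JE : J = ((2^-1)%:E * (\int[mu]_(z in ~` Om) h z) + exterior_excess v)%E.
  pose e z := (\int[mu]_(y in Om) k z y * (v z - neumann_average Om s v z) ^+ 2)%:E.
  have e0 z : (0 <= e z)%E.
    rewrite lee_fin mulr_ge0 ?sqr_ge0//; apply: Rintegral_ge0 => y _.
    exact: frac_kernel_ge0.
  have me : measurable_fun (~` Om) e.
    apply: measurable_funTS; apply/measurable_EFinP; apply: measurable_funM.
      exact: (measurableT_comp _ mN).
    apply: measurable_funX; apply: measurable_funB => //.
    exact: measurable_neumann_average.
  rewrite /J (@ae_eq_integralW _ _ _ _ _ _
    (fun z => (2^-1)%:E * h z + e z)%E); last first.
    exact: ae_exterior.
  rewrite ge0_integralD//.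
  - by rewrite ge0_integralZl_EFin// invr_ge0.
  - by move=> z _; rewrite mule_ge0// lee_fin invr_ge0.
  - exact: measurable_funeM.
rewrite EN ER JE; apply: energy_arith.
- by case/andP: s01; rewrite subr_gt0.
- exact: integral_ge0.
- exact: integral_ge0.
- apply: integral_ge0 => z _; rewrite lee_fin mulr_ge0 ?sqr_ge0//.
  by apply: Rintegral_ge0 => y _; exact: frac_kernel_ge0.
Qed.

End energy.
(** * The Neumann and regional spaces *)

Section L2.
Context (R : realType) (d : nat) (Om : set 'rV[R]_d) (mOm : measurable Om).
Local Notation mu := (leb_rV R d).
Implicit Types v : 'rV[R]_d -> R.

Let one := cst 1%E : 'rV[R]_d -> \bar R.

Let mone : measurable_fun setT one. Proof. exact: measurable_cst. Qed.

Let one0 z : (0 <= one z)%E. Proof. by rewrite lee_fin. Qed.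

Lemma L2_weighted_form v :
  (\int[mu]_(x in Om) (v x ^+ 2)%:E)%E = weighted_form mu Om one v.
Proof. by apply: eq_integral => x _; rewrite /one mule1. Qed.

Lemma L2_domD a u v : L2_dom Om u -> L2_dom Om v ->
  L2_dom Om (fun x => a * u x + v x).
Proof.
move=> [mu_ u2] [mv v2]; split; first exact: ae_measurableD.
rewrite L2_weighted_form in u2; rewrite L2_weighted_form in v2.
by rewrite L2_weighted_form; exact: (weighted_form_lty mOm mone one0).
Qed.

Lemma L2_dom0 : L2_dom Om (fun=> 0 : R).
Proof.
split; first exact: measurable_ae_measurable.
by rewrite integral0_eq ?ltry// => x _; rewrite expr0n.
Qed.

Lemma L2_dom_ae v v' : {ae mu, forall x, Om x -> v x = v' x} ->
  L2_dom Om v -> L2_dom Om v'.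
Proof.
move=> vv' [mv v2]; split; first exact: ae_measurable_eq mv.
rewrite L2_weighted_form -(@weighted_form_ae _ _ _ _ _ _ v)//.
by rewrite -L2_weighted_form.
Qed.

Lemma L2_norm_ae v v' : {ae mu, forall x, Om x -> v x = v' x} ->
  L2_norm Om v = L2_norm Om v'.
Proof.
move=> vv'; rewrite /L2_norm /Rintegral !L2_weighted_form.
by rewrite (@weighted_form_ae _ _ _ _ _ _ v v').
Qed.

Lemma sqrt_fineZ (a : R) (q : \bar R) : (0 <= q)%E -> (q < +oo)%E ->
  Num.sqrt (fine ((a ^+ 2)%:E * q)%E) = `|a| * Num.sqrt (fine q).
Proof.
by case: q => [q| |]// _ _ /=; rewrite sqrtrM ?sqr_ge0// sqrtr_sqr.
Qed.

Lemma L2_normZ a v : L2_dom Om v -> L2_norm Om (fun x => a * v x) = `|a| * L2_norm Om v.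
Proof.
move=> [mv v2]; rewrite L2_weighted_form in v2.
rewrite /L2_norm /Rintegral !L2_weighted_form.
rewrite (weighted_formZ mOm mone one0 _ mv) sqrt_fineZ//.
exact: weighted_form_ge0.
Qed.

End L2.

Section spaces.
Context (R : realType) (d : nat) (Om : set 'rV[R]_d) (s : R).
Hypotheses (mOm : measurable Om) (Om_fin : (leb_rV R d Om < +oo)%E)
  (bOm : (leb_rV R d).-negligible (closure Om `\` Om)) (s01 : 0 < s < 1).
Local Notation mu := (leb_rV R d).
Local Notation mu2 := (leb_rV R d \x leb_rV R d)%E.
Local Notation k := (@frac_kernel R d s).
Implicit Types u v w phi : 'rV[R]_d -> R.

Let s1_ge0 : 0 <= 1 - s. Proof. by case/andP: s01 => _ ?; rewrite subr_ge0 ltW. Qed.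
Let s2_ge0 : 0 <= (1 - s) / 2. Proof. by rewrite divr_ge0. Qed.

Let diff v (z : 'rV[R]_d * 'rV[R]_d) := v z.1 - v z.2.
Let kN (z : 'rV[R]_d * 'rV[R]_d) : \bar R := (k z.1 z.2)%:E.
Let kR (z : 'rV[R]_d * 'rV[R]_d) : \bar R := regional_kernel Om s z.1 z.2.
Let Q := Q_set Om.
Let OO := Om `*` Om.
Let WN p := weighted_form mu2 Q kN p.
Let WR p := weighted_form mu2 OO kR p.

Let mkN : measurable_fun setT kN.
Proof. by apply/measurable_EFinP; exact: measurable_frac_kernel. Qed.
Let kN0 z : (0 <= kN z)%E. Proof. by rewrite lee_fin frac_kernel_ge0. Qed.
Let mkR : measurable_fun setT kR. Proof. exact: measurable_regional_kernel. Qed.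
Let kR0 z : (0 <= kR z)%E. Proof. exact: regional_kernel_ge0. Qed.
Let mQ : measurable Q.
Proof. by apply: measurableC; apply: measurableX; exact: measurableC. Qed.
Let mOO : measurable OO. Proof. exact: measurableX. Qed.

Let neumann_energyE v : neumann_energy Om s v = (((1 - s) / 2)%:E * WN (diff v))%E.
Proof. by congr mule; apply: eq_integral => z _; rewrite EFinM. Qed.

Let regional_energyE v : regional_energy Om s v = WR (diff v).
Proof. by []. Qed.

Let diffD a u v : diff (fun x => a * u x + v x) = (fun z => a * diff u z + diff v z).
Proof. by apply/funext => z; rewrite /diff; ring. Qed.

Let diffZ a v : diff (fun x => a * v x) = (fun z => a * diff v z).
Proof. by apply/funext => z; rewrite /diff; ring. Qed.

Let mdR v : ae_measurable mu Om v -> ae_measurable mu2 OO (diff v).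
Proof. exact: ae_measurable_difference. Qed.

Let mdN v : ae_measurable mu setT v -> ae_measurable mu2 Q (diff v).
Proof. by apply: ae_measurable_difference => z _. Qed.

Let diff_ae (D : set ('rV[R]_d * 'rV[R]_d)) E v v' : D `<=` E `*` E ->
  {ae mu, forall x, E x -> v x = v' x} ->
  {ae mu2, forall z, D z -> diff v z = diff v' z}.
Proof.
move=> DE vv'.
apply: filterS2 (ae_product1 mu vv') (ae_product2 mu vv') => z v1 v2 /DE[E1 E2].
by rewrite /diff v1// v2.
Qed.

Lemma regional_energy_ae v v' : {ae mu, forall x, Om x -> v x = v' x} ->
  regional_energy Om s v = regional_energy Om s v'.
Proof. by move=> vv'; apply: weighted_form_ae; exact: diff_ae vv'. Qed.

Let aeT v v' : {ae mu, forall x, v x = v' x} ->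
  {ae mu, forall x, [set: 'rV[R]_d] x -> v x = v' x}.
Proof. by apply: filterS. Qed.

Lemma neumann_energy_ae v v' : {ae mu, forall x, v x = v' x} ->
  neumann_energy Om s v = neumann_energy Om s v'.
Proof.
move=> vv'; rewrite !neumann_energyE; congr mule; apply: weighted_form_ae.
by apply: diff_ae (aeT vv') => z _.
Qed.

Lemma regional_energy_ge0 v : (0 <= regional_energy Om s v)%E.
Proof. exact: weighted_form_ge0. Qed.

Lemma neumann_energy_ge0 v : (0 <= neumann_energy Om s v)%E.
Proof. by rewrite neumann_energyE mule_ge0// weighted_form_ge0. Qed.

Let neumann_energy_fin v : (neumann_energy Om s v < +oo)%E -> (WN (diff v) < +oo)%E.
Proof.
have c0 : 0 < (1 - s) / 2 by case/andP: s01 => _ ?; rewrite divr_gt0// subr_gt0.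
rewrite neumann_energyE; have : (0 <= WN (diff v))%E by exact: weighted_form_ge0.
case: (WN _) => [x _ _|_|//]; first exact: ltry.
by rewrite gt0_muley ?lte_fin.
Qed.

Let fin_neumann_energy v : (WN (diff v) < +oo)%E -> (neumann_energy Om s v < +oo)%E.
Proof. by move=> h; rewrite neumann_energyE lte_mul_pinfty// lee_fin. Qed.

Lemma seminormed_regional : seminormed (regional_space Om s).
Proof.
split => /=.
- split; first exact: L2_dom0.
  rewrite /regional_energy integral0_eq ?ltry// => z _.
  by rewrite subrr expr0n mul0e.
- move=> a u v [u2 uE] [v2 vE]; split; first exact: L2_domD.
  rewrite regional_energyE diffD.
  by apply: (weighted_form_lty mOO mkR kR0) => //; apply: mdR; [case: u2|case: v2].
- by move=> v; rewrite addr_ge0 ?sqrtr_ge0.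
- move=> a v [v2 vE]; rewrite (L2_normZ mOm)// mulrDr; congr (_ + _).
  rewrite regional_energyE diffZ /WR (weighted_formZ mOO mkR kR0 _ (mdR v2.1)).
  by rewrite sqrt_fineZ//; exact: weighted_form_ge0.
Qed.

Lemma seminormed_neumann : seminormed (neumann_space Om s).
Proof.
split => /=.
- split; [exact: measurable_ae_measurable|exact: L2_dom0|].
  apply: fin_neumann_energy; rewrite /WN /weighted_form integral0_eq ?ltry// => z _.
  by rewrite /diff subrr expr0n mul0e.
- move=> a u v [mu_ u2 uE] [mv v2 vE].
  split; [exact: ae_measurableD|exact: L2_domD|].
  apply: fin_neumann_energy; rewrite diffD.
  by apply: (weighted_form_lty mQ mkN kN0);
    by [exact: mdN|exact: neumann_energy_fin].
- by move=> v; rewrite addr_ge0 ?sqrtr_ge0.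
- move=> a v [mv v2 vE]; rewrite (L2_normZ mOm)// mulrDr; congr (_ + _).
  rewrite neumann_energyE diffZ /WN (weighted_formZ mQ mkN kN0 _ (mdN mv)).
  by rewrite muleCA -/(WN _) -neumann_energyE sqrt_fineZ// neumann_energy_ge0.
Qed.

Lemma neumann_average_ae v v' z : {ae mu, forall x, Om x -> v x = v' x} ->
  neumann_average Om s v z = neumann_average Om s v' z.
Proof.
move=> vv'; rewrite /neumann_average; congr (fine _ / _).
by apply: ae_eq_integralW; apply: filterS vv' => x vv' Omx; rewrite vv'.
Qed.

Lemma exterior_excess_ae v v' : {ae mu, forall x, v x = v' x} ->
  exterior_excess Om s v = exterior_excess Om s v'.
Proof.
move=> vv'; apply: ae_eq_integralW; apply: filterS (vv') => z -> _.
rewrite (@neumann_average_ae v v')//.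
by apply: filterS vv' => x ->.
Qed.

Lemma energy_identity v : ae_measurable mu setT v -> L2_dom Om v ->
  neumann_energy Om s v =
  ((2^-1)%:E * regional_energy Om s v + (1 - s)%:E * exterior_excess Om s v)%E.
Proof.
move=> [g mg vg] v2.
have {}vg : {ae mu, forall x, v x = g x} by apply: filterS vg => x; exact.
have vgO : {ae mu, forall x, Om x -> v x = g x} by apply: filterS vg.
have [_ g2] := L2_dom_ae vgO v2.
rewrite (neumann_energy_ae vg) (regional_energy_ae vgO) (exterior_excess_ae vg).
exact: energy_identity_measurable.
Qed.

Lemma exterior_excess_ge0 v : (0 <= exterior_excess Om s v)%E.
Proof.
apply: integral_ge0 => z _; rewrite lee_fin mulr_ge0 ?sqr_ge0//.
by apply: Rintegral_ge0 => y _; exact: frac_kernel_ge0.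
Qed.

Lemma neumann_averageD a u v z : L2_dom Om u -> L2_dom Om v -> ~ closure Om z ->
  neumann_average Om s (fun x => a * u x + v x) z =
  a * neumann_average Om s u z + neumann_average Om s v z.
Proof.
move=> u2 v2 zOm.
have [[gu mgu ugu] _] := u2; have [[gv mgv vgv] _] := v2.
have [_ gu2] := L2_dom_ae ugu u2; have [_ gv2] := L2_dom_ae vgv v2.
rewrite (neumann_average_ae z ugu) (neumann_average_ae z vgv).
rewrite (@neumann_average_ae _ (fun x => a * gu x + gv x)); last first.
  by apply: filterS2 ugu vgv => x ugu vgv Omx; rewrite ugu// vgv.
have [_ iu _] := exterior_integrable mOm Om_fin s01 mgu gu2 zOm.
have [_ iv _] := exterior_integrable mOm Om_fin s01 mgv gv2 zOm.
rewrite /neumann_average mulrA -mulrDl; congr (_ / _).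
have iau : mu.-integrable Om (EFin \o (fun x => a * (gu x * k z x))).
  by have := integrableZl mOm a iu; apply: eq_integrable.
rewrite -(RintegralZl a mOm iu) -(RintegralD mOm iau iv).
by apply: eq_Rintegral => x _; ring.
Qed.

(** The extension minimizing the Neumann energy: its fractional Neumann
    derivative vanishes outside the closure of [Om]. The value on the boundary,
    a null set, is arbitrary. *)
Definition neumann_extension v : 'rV[R]_d -> R := fun x =>
  if `[< Om x >] then v x
  else if `[< closure Om x >] then 0 else neumann_average Om s v x.

Lemma neumann_extension_in v x : Om x -> neumann_extension v x = v x.
Proof. by move=> Omx; rewrite /neumann_extension asboolT. Qed.

Lemma neumann_extension_out v x : ~ closure Om x ->
  neumann_extension v x = neumann_average Om s v x.
Proof.
move=> clx; rewrite /neumann_extension asboolF ?asboolF//.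
by move=> Omx; apply: clx; exact: subset_closure.
Qed.

Lemma neumann_extension_linear a u v : L2_dom Om u -> L2_dom Om v ->
  neumann_extension (fun x => a * u x + v x) =
  fun x => a * neumann_extension u x + neumann_extension v x.
Proof.
move=> u2 v2; apply/funext => x; rewrite /neumann_extension.
have [//|nOm] := asboolP (Om x); have [|clx] := asboolP (closure Om x).
  by rewrite mulr0 addr0.
exact: neumann_averageD.
Qed.

Let aeO v v' : (forall x, Om x -> v x = v' x) ->
  {ae mu, forall x, Om x -> v x = v' x}.
Proof. by move=> vv'; apply: aeW => x /vv'. Qed.

Lemma neumann_average_eq v v' z : (forall x, Om x -> v x = v' x) ->
  neumann_average Om s v z = neumann_average Om s v' z.
Proof. by move=> /aeO; exact: neumann_average_ae. Qed.

Lemma exterior_excess_eq0 v : (forall z, ~ closure Om z ->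
    v z = neumann_average Om s v z) -> exterior_excess Om s v = 0%E.
Proof.
move=> va; rewrite /exterior_excess (@ae_eq_integralW _ _ _ _ _ _ (cst 0%E)).
  exact: integral0.
apply: (ae_exterior bOm) => z /va <-.
by rewrite subrr expr0n mulr0.
Qed.

Lemma ae_eq_exterior v v' : (forall x, Om x -> v x = v' x) ->
  (forall x, ~ closure Om x -> v x = v' x) -> {ae mu, forall x, v x = v' x}.
Proof.
move=> vO vE; apply: negligibleS bOm => x /= vx; split.
  by apply: contrapT => /vE.
by move/vO.
Qed.

Lemma neumann_extension_measurable v : L2_dom Om v ->
  ae_measurable mu setT (neumann_extension v).
Proof.
move=> [[g mg vg] v2].
exists (fun x => \1_Om x * g x + \1_(~` Om) x * neumann_average Om s g x).
  apply: measurable_funD; apply: measurable_funM.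
  - exact: measurable_indic.
  - exact: mg.
  - by apply: measurable_indic; exact: measurableC.
  - exact: measurable_neumann_average.
have E : {ae mu, forall x, neumann_extension v x =
    (\1_Om x * neumann_extension v x + \1_(~` Om) x * neumann_average Om s v x)}.
  apply: ae_eq_exterior => x h; rewrite !indicE.
    by rewrite mem_set// memNset ?mul1r ?mul0r ?addr0//=; exact.
  have nOm : ~ Om x by move=> Omx; apply: h; exact: subset_closure.
  by rewrite memNset// mem_set//= mul0r mul1r add0r neumann_extension_out.
apply: filterS2 E (vg) => x -> vgx _; rewrite (neumann_average_ae x (v' := g)).
  congr (_ + _); rewrite indicE.
  have [xOm|] := boolP (x \in Om); last by rewrite !mul0r.
  have Omx := set_mem xOm; by rewrite !mul1r neumann_extension_in ?vgx.
exact: vg.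
Qed.

Lemma neumann_energy_extension v : L2_dom Om v ->
  neumann_energy Om s (neumann_extension v) =
  ((2^-1)%:E * regional_energy Om s v)%E.
Proof.
move=> v2; have ve x : Om x -> neumann_extension v x = v x.
  exact: neumann_extension_in.
rewrite energy_identity//; last 2 first.
- exact: neumann_extension_measurable.
- by apply: L2_dom_ae v2; apply: aeO => x /ve.
rewrite exterior_excess_eq0 ?mule0 ?adde0; last first.
  move=> z zOm; rewrite neumann_extension_out//.
  by apply: neumann_average_eq => x /ve.
by congr mule; apply: regional_energy_ae; exact: aeO.
Qed.

(** The operator bound is [1]: the extension has half the regional energy,
    having no excess. *)
Lemma bounded_linear_extension :
  bounded_linear (regional_space Om s) (neumann_space Om s) neumann_extension 1.
Proof.
have ve v x : Om x -> v x = neumann_extension v x.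
  by move=> Omx; rewrite neumann_extension_in.
split => //.
- move=> v [v2 vE]; split.
  + exact: neumann_extension_measurable.
  + by apply: L2_dom_ae v2; apply: aeO; exact: ve.
  + by rewrite neumann_energy_extension// lte_mul_pinfty// lee_fin.
- by move=> a u v [u2 _] [v2 _]; exact: neumann_extension_linear.
- move=> v [v2 vE]; rewrite mul1r /= -(L2_norm_ae (aeO (ve v))) lerD2l.
  rewrite neumann_energy_extension// ler_wsqrtr//.
  have := regional_energy_ge0 v; move: vE; case: (regional_energy _ _ _) => [x| |]//=.
  by rewrite lee_fin => _ x0; rewrite ler_piMl// invf_le1// ler1n.
Qed.

Lemma regional_energy_le v : ae_measurable mu setT v -> L2_dom Om v ->
  (regional_energy Om s v <= 2%:E * neumann_energy Om s v)%E.
Proof.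
move=> mv v2; rewrite energy_identity// ge0_muleDr; last 2 first.
- by rewrite mule_ge0 ?regional_energy_ge0// lee_fin.
- by rewrite mule_ge0 ?exterior_excess_ge0// lee_fin.
rewrite muleA -EFinM divff// mul1e leeDl//.
by rewrite !mule_ge0 ?exterior_excess_ge0// lee_fin.
Qed.

Lemma restrict_dom_in v x : Om x -> restrict_dom Om v x = v x.
Proof. by move=> Omx; rewrite /restrict_dom patchT// mem_set. Qed.

Lemma restrict_dom_linear a u v : restrict_dom Om (fun x => a * u x + v x) =
  fun x => a * restrict_dom Om u x + restrict_dom Om v x.
Proof.
apply/funext => x; rewrite /restrict_dom /patch; case: ifP => //.
by rewrite mulr0 addr0.
Qed.

(** The energy identity bounds the regional energy by twice the Neumann energy,
    whence the constant. *)
Lemma bounded_linear_restriction :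
  bounded_linear (neumann_space Om s) (regional_space Om s) (restrict_dom Om)
    (Num.sqrt 2).
Proof.
have vr v : {ae mu, forall x, Om x -> v x = restrict_dom Om v x}.
  by apply: aeO => x Omx; rewrite restrict_dom_in.
have h v : fdom (neumann_space Om s) v -> (regional_energy Om s v < +oo)%E.
  move=> [mv v2 vE]; apply: le_lt_trans (regional_energy_le mv v2) _.
  by rewrite lte_mul_pinfty// lee_fin.
split.
- by rewrite sqrtr_gt0.
- move=> v Nv; have [mv v2 vE] := Nv; split; first exact: L2_dom_ae v2.
  by rewrite -(regional_energy_ae (vr v)) h.
- by move=> a u v _ _; exact: restrict_dom_linear.
- move=> v Nv; have [mv v2 vE] := Nv.
  rewrite /= -(L2_norm_ae (vr v)) -(regional_energy_ae (vr v)) mulrDr lerD//.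
    by rewrite ler_peMl ?sqrtr_ge0// -[leLHS]sqrtr1 ler_wsqrtr// ler1n.
  rewrite -sqrtrM// ler_wsqrtr// -[2]/(fine 2%:E) -fineM//; last first.
    by rewrite ge0_fin_numE// neumann_energy_ge0.
  apply: fine_le; last exact: regional_energy_le.
    by rewrite ge0_fin_numE ?h// regional_energy_ge0.
  rewrite ge0_fin_numE; first by rewrite lte_mul_pinfty// lee_fin.
  by rewrite mule_ge0 ?neumann_energy_ge0// lee_fin.
Qed.

Let neumann_formE p q : fdom (neumann_space Om s) p -> fdom (neumann_space Om s) q ->
  neumann_form Om s p q =
  4^-1 * (fine (neumann_energy Om s (fun x => 1 * p x + q x)) -
          fine (neumann_energy Om s (fun x => -1 * q x + p x))).
Proof.
move=> [mp p2 pE] [mq q2 qE].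
have pf := neumann_energy_fin pE; have qf := neumann_energy_fin qE.
have sf := weighted_form_lty mQ mkN kN0 1 (mdN mp) (mdN mq) pf qf.
have tf := weighted_form_lty mQ mkN kN0 (-1) (mdN mq) (mdN mp) qf pf.
rewrite /neumann_form /Rintegral.
rewrite (eq_integral (fun z => ((diff p z * diff q z)%:E * kN z)%E)); last first.
  by move=> z _; rewrite -EFinM.
rewrite (weighted_form_polarization mQ mkN kN0 (mdN mp) (mdN mq) pf qf).
rewrite !neumann_energyE !diffD !fineM//.
- by rewrite /WN /=; ring.
- by rewrite ge0_fin_numE// weighted_form_ge0.
- by rewrite ge0_fin_numE// weighted_form_ge0.
Qed.

Let regional_formE p q : fdom (regional_space Om s) p ->
  fdom (regional_space Om s) q ->
  regional_form Om s p q =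
  2^-1 * (4^-1 * (fine (regional_energy Om s (fun x => 1 * p x + q x)) -
          fine (regional_energy Om s (fun x => -1 * q x + p x)))).
Proof.
move=> [p2 pf] [q2 qf].
rewrite /regional_form.
rewrite (weighted_form_polarization mOO mkR kR0 (mdR p2.1) (mdR q2.1) pf qf).
by rewrite !regional_energyE !diffD.
Qed.

Lemma regional_form_eq p p' q q' : (forall x, Om x -> p x = p' x) ->
  (forall x, Om x -> q x = q' x) ->
  regional_form Om s p q = regional_form Om s p' q'.
Proof.
move=> pp' qq'; rewrite /regional_form; congr (_ * fine _).
by apply: eq_integral => z /[1!inE] -[z1 z2]; rewrite !pp'// !qq'.
Qed.

(** By polarization: adding to [p] or subtracting from it a function [q] that
    equals its average outside leaves the excess unchanged, so that only the
    regional energies contribute. *)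
Lemma neumann_form_average p q : fdom (neumann_space Om s) p ->
  fdom (neumann_space Om s) q ->
  (forall z, ~ closure Om z -> q z = neumann_average Om s q z) ->
  neumann_form Om s p q = regional_form Om s p q.
Proof.
move=> Np Nq qa; have sN := seminormed_neumann.
have NR v : fdom (neumann_space Om s) v -> fdom (regional_space Om s) v.
  move=> [mv v2 vE]; split => //; apply: le_lt_trans (regional_energy_le mv v2) _.
  by rewrite lte_mul_pinfty// lee_fin.
have fE v : fdom (neumann_space Om s) v -> fine (neumann_energy Om s v) =
    2^-1 * fine (regional_energy Om s v) +
    fine ((1 - s)%:E * exterior_excess Om s v)%E.
  move=> Nv; have [mv v2 vE] := Nv; have [_ vR] := NR v Nv.
  have rf : regional_energy Om s v \is a fin_num.
    by rewrite ge0_fin_numE// regional_energy_ge0.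
  have e0 : (0 <= (1 - s)%:E * exterior_excess Om s v)%E.
    by rewrite mule_ge0 ?exterior_excess_ge0// lee_fin.
  have ef : ((1 - s)%:E * exterior_excess Om s v)%E \is a fin_num.
    rewrite ge0_fin_numE//; apply: le_lt_trans vE.
    rewrite (energy_identity mv v2) leeDr//.
    by rewrite mule_ge0 ?regional_energy_ge0// lee_fin.
  have hf : ((2^-1)%:E * regional_energy Om s v)%E \is a fin_num by rewrite fin_numM.
  by rewrite (energy_identity mv v2) (fineD hf ef) fineM.
rewrite (neumann_formE Np Nq) (regional_formE (NR _ Np) (NR _ Nq)).
rewrite (fE _ (fdomD sN 1 Np Nq)) (fE _ (fdomD sN (-1) Nq Np)).
have [_ p2 _] := Np; have [_ q2 _] := Nq.
have -> : exterior_excess Om s (fun x => 1 * p x + q x) =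
    exterior_excess Om s (fun x => -1 * q x + p x).
  apply: ae_eq_integralW; apply: (ae_exterior bOm) => z zOm.
  rewrite !neumann_averageD// -(qa z zOm); congr ((_ * _ ^+ 2)%:E); ring.
ring.
Qed.

Lemma neumann_formC p q : neumann_form Om s p q = neumann_form Om s q p.
Proof.
rewrite /neumann_form; congr (_ * _); apply: eq_Rintegral => z _.
by congr (_ * _); rewrite mulrC.
Qed.

Lemma neumann_form_ae p p' q : {ae mu, forall x, p x = p' x} ->
  neumann_form Om s p q = neumann_form Om s p' q.
Proof.
move=> pp'; rewrite /neumann_form; congr (_ * fine _).
apply: ae_eq_integralW.
apply: filterS2 (ae_product1 mu pp') (ae_product2 mu pp') => z -> -> _ //.
Qed.

(** With the next lemma, this exchanges the two weak formulations: regional test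
    functions are extended, Neumann test functions are restricted. *)
Lemma neumann_form_extension_r w phi : fdom (neumann_space Om s) w ->
  fdom (regional_space Om s) phi ->
  neumann_form Om s w (neumann_extension phi) =
  regional_form Om s (restrict_dom Om w) phi.
Proof.
move=> Nw Rphi; rewrite neumann_form_average//.
- apply: regional_form_eq => x Omx; first by rewrite restrict_dom_in.
  by rewrite neumann_extension_in.
- exact: (bounded_linear_dom bounded_linear_extension).
- move=> z zOm; rewrite neumann_extension_out//.
  by apply: neumann_average_eq => x Omx; rewrite neumann_extension_in.
Qed.

Lemma neumann_form_extension_l w phi : fdom (regional_space Om s) w ->
  fdom (neumann_space Om s) phi ->
  neumann_form Om s (neumann_extension w) phi =
  regional_form Om s w (restrict_dom Om phi).
Proof.
move=> Rw Nphi; rewrite neumann_formC neumann_form_extension_r//.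
by rewrite /regional_form; congr (_ * fine _); apply: eq_integral => z _;
  rewrite [X in X%:E]mulrC.
Qed.

Lemma neumann_space_ae v v' : {ae mu, forall x, v x = v' x} ->
  fdom (neumann_space Om s) v -> fdom (neumann_space Om s) v' /\
  fnorm (neumann_space Om s) v = fnorm (neumann_space Om s) v'.
Proof.
move=> vv' [mv v2 vE]; have vO : {ae mu, forall x, Om x -> v x = v' x}.
  by apply: filterS vv'.
split; last by rewrite /= (L2_norm_ae vO) (neumann_energy_ae vv').
split; [|exact: L2_dom_ae v2|by rewrite -(neumann_energy_ae vv')].
by apply: ae_measurable_eq mv; exact: aeT.
Qed.

End spaces.
(** * Energy of the initial datum *)

Section initial_datum.
Context (R : realType) (d : nat) (Om : set 'rV[R]_d) (s : R).
Hypotheses (mOm : measurable Om) (Om_fin : (leb_rV R d Om < +oo)%E)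
  (bOm : (leb_rV R d).-negligible (closure Om `\` Om)) (s01 : 0 < s < 1).
Local Notation mu := (leb_rV R d).
Local Notation mu2 := (leb_rV R d \x leb_rV R d)%E.
Implicit Types v : 'rV[R]_d -> R.

Let OO := Om `*` Om.
Let mOO : measurable OO. Proof. exact: measurableX. Qed.
Let diff v (z : 'rV[R]_d * 'rV[R]_d) := v z.1 - v z.2.
Let m := fine (mu Om).

Let mE : mu Om = m%:E.
Proof. by rewrite fineK// ge0_fin_numE. Qed.

Let m0 : 0 <= m. Proof. by rewrite fine_ge0. Qed.

Lemma square_difference_le v : L2_dom Om v ->
  (\int[mu2]_(z in OO) (diff v z ^+ 2)%:E <=
   (4 * m)%:E * \int[mu]_(x in Om) (v x ^+ 2)%:E)%E.
Proof.
move=> v2; have [[g mg vg] _] := v2.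
have dvg : {ae mu2, forall z, OO z -> diff v z = diff g z}.
  apply: filterS2 (ae_product1 mu vg) (ae_product2 mu vg) => z v1 v2' [z1 z2].
  by rewrite /diff v1// v2'.
rewrite (@ae_eq_integralW _ _ _ _ _ _ (fun z => (diff g z ^+ 2)%:E)); last first.
  by apply: filterS dvg => z dvg /dvg ->.
rewrite (@ae_eq_integralW _ _ _ mu Om _ (fun x => (g x ^+ 2)%:E)); last first.
  by apply: filterS vg => x vg /vg ->.
pose f1 (z : 'rV[R]_d * 'rV[R]_d) := (g z.1 ^+ 2)%:E.
pose f2 (z : 'rV[R]_d * 'rV[R]_d) := (g z.2 ^+ 2)%:E.
have mf1 : measurable_fun setT f1.
  by apply/measurable_EFinP; apply: measurable_funX; exact: (measurableT_comp mg).
have mf2 : measurable_fun setT f2.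
  by apply/measurable_EFinP; apply: measurable_funX; exact: (measurableT_comp mg).
have f10 z : (0 <= f1 z)%E by rewrite lee_fin sqr_ge0.
have f20 z : (0 <= f2 z)%E by rewrite lee_fin sqr_ge0.
pose I := (\int[mu]_(x in Om) (g x ^+ 2)%:E)%E.
have IE : (\int[mu]_(x in Om) (m%:E * (g x ^+ 2)%:E) = m%:E * I)%E.
  apply: (ge0_integralZl_EFin mu mOm (f1 := fun x => (g x ^+ 2)%:E)) => //.
  - by move=> x _; rewrite lee_fin sqr_ge0.
  - by apply: measurable_funTS; apply/measurable_EFinP; exact: measurable_funX.
have i1 : (\int[mu2]_(z in OO) f1 z = m%:E * I)%E.
  apply: eq_trans (tonelli_rect1 mu mu mOm mOm mf1 f10) _; rewrite -IE.
  by apply: eq_integral => x _;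
    rewrite (eq_integral (cst (g x ^+ 2)%:E))// integral_cst// [X in (_ * X)%E]mE muleC.
have i2 : (\int[mu2]_(z in OO) f2 z = m%:E * I)%E.
  apply: eq_trans (tonelli_rect2 mu mu mOm mOm mf2 f20) _; rewrite -IE.
  by apply: eq_integral => x _;
    rewrite (eq_integral (cst (g x ^+ 2)%:E))// integral_cst// [X in (_ * X)%E]mE muleC.
pose mm := sigma_finite_product mu mu.
have c0 (f : _ -> \bar R) (f0 : forall z, (0 <= f z)%E) z : OO z -> (0 <= 2%:E * f z)%E.
  by move=> _; rewrite mule_ge0// lee_fin.
apply: (@le_trans _ _ (\int[mm]_(z in OO) (2%:E * f1 z + 2%:E * f2 z))%E).
  apply: ge0_le_ae_integral.
  - by move=> z _; rewrite lee_fin sqr_ge0.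
  - by move=> z OOz; rewrite adde_ge0// c0.
  - apply: aeW => z _; rewrite -!EFinM -EFinD lee_fin -subr_ge0 /diff.
    rewrite (_ : _ - _ = (g z.1 + g z.2) ^+ 2); first exact: sqr_ge0.
    by ring.
have mc (f : _ -> \bar R) : measurable_fun setT f ->
    measurable_fun OO (fun z => 2%:E * f z)%E.
  by move=> mf; apply: measurable_funeM; exact: measurable_funTS.
rewrite (ge0_integralD mm mOO (c0 _ f10) (mc _ mf1) (c0 _ f20) (mc _ mf2)).
rewrite (ge0_integralZl_EFin mm mOO (fun z _ => f10 z) (measurable_funTS mf1))//.
rewrite (ge0_integralZl_EFin mm mOO (fun z _ => f20 z) (measurable_funTS mf2))//.
have I0 : (0 <= I)%E by apply: integral_ge0 => x _; rewrite lee_fin sqr_ge0.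
rewrite [X in (2%:E * X + _)%E]i1 [X in (_ + 2%:E * X)%E]i2.
rewrite !muleA -!EFinM -ge0_muleDl ?lee_fin ?mulr_ge0//.
rewrite -EFinD lee_wpmul2r// lee_fin; lra.
Qed.

(** Lower semicontinuity of the regional energy under convergence in L^2. The
    kernel is first truncated, so that its energy is controlled by the L^2 norm,
    and the truncation is then removed by monotone convergence. *)
Lemma regional_energy_limit (C : R) v0 : 0 <= C -> L2_dom Om v0 ->
  (forall e, 0 < e -> exists v, [/\ L2_dom Om v,
     (\int[mu]_(x in Om) ((v0 x - v x) ^+ 2)%:E <= e%:E)%E &
     (regional_energy Om s v <= C%:E)%E]) ->
  (regional_energy Om s v0 <= (2 * C)%:E)%E.
Proof.
move=> C0 v02 H.
pose K (z : 'rV[R]_d * 'rV[R]_d) := regional_kernel Om s z.1 z.2.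
have mK : measurable_fun setT K by exact: measurable_regional_kernel.
have K0 z : (0 <= K z)%E by exact: regional_kernel_ge0.
pose Kn n z := mine (K z) n%:R%:E.
have mKn n : measurable_fun setT (Kn n).
  by apply: measurable_mine => //; exact: measurable_cst.
have Kn0 n z : (0 <= Kn n z)%E by rewrite /Kn le_min K0/= lee_fin ler0n.
have mdiff v : L2_dom Om v -> ae_measurable mu2 OO (diff v).
  by move=> [mv _]; exact: ae_measurable_difference mv.
have trunc n : (weighted_form mu2 OO (Kn n) (diff v0) <= (2 * C)%:E)%E.
  apply/lee_addgt0Pr => eps eps0.
  (* [8 * n * m * e <= eps]: a factor 2 from [weighted_formD], [n] from the
     truncated kernel and [4 * m] from [square_difference_le] *)
  pose e := eps / (8 * n%:R * m + 1).
  have D0 : 0 < 8 * n%:R * m + 1 by rewrite ltr_wpDl// !mulr_ge0.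
  have [|v [v2 ve vC]] := H e; first by rewrite divr_gt0.
  have r2 : L2_dom Om (fun x => v0 x - v x).
    have := L2_domD mOm (-1) v2 v02; congr (L2_dom Om _).
    by apply/funext => x; rewrite mulN1r addrC.
  have -> : diff v0 = (fun z => 1 * diff v z + diff (fun x => v0 x - v x) z).
    by apply/funext => z; rewrite /diff; ring.
  apply: le_trans (weighted_formD mOO (mKn n) (Kn0 n) 1 (mdiff _ v2) (mdiff _ r2)) _.
  rewrite expr1n mulr1 EFinM; apply: leeD.
    rewrite lee_wpmul2l// ?lee_fin//; apply: le_trans vC.
    apply: ge0_le_ae_integral.
    - by move=> z _; rewrite mule_ge0// lee_fin sqr_ge0.
    - by move=> z _; rewrite mule_ge0// ?K0// lee_fin sqr_ge0.
    - by apply: aeW => z _; rewrite lee_wpmul2l ?lee_fin ?sqr_ge0// ge_min lexx.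
  apply: (@le_trans _ _ (2%:E * (n%:R%:E * ((4 * m)%:E * e%:E)))%E).
    rewrite lee_wpmul2l ?lee_fin//.
    apply: (@le_trans _ _ (n%:R%:E *
      \int[mu2]_(z in OO) (diff (fun x => v0 x - v x)%R z ^+ 2)%:E)%E); last first.
      rewrite lee_wpmul2l ?lee_fin//; apply: le_trans (square_difference_le r2) _.
      by rewrite lee_wpmul2l// lee_fin mulr_ge0.
    have [->|n0] := eqVneq n 0%N.
      rewrite mul0e /weighted_form integral0_eq// => z _.
      by rewrite /Kn min_r ?mule0.
    apply: le_trans; last first.
      apply: ge0_integralZl_le; first by rewrite ltr0n lt0n.
      by move=> z _; rewrite lee_fin sqr_ge0.
    apply: ge0_le_ae_integral.
    - by move=> z _; rewrite mule_ge0// lee_fin sqr_ge0.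
    - by move=> z _; rewrite -EFinM lee_fin mulr_ge0 ?sqr_ge0.
    - apply: aeW => z _; rewrite muleC lee_wpmul2r ?lee_fin ?sqr_ge0//.
      by rewrite ge_min lexx orbT.
  rewrite -!EFinM lee_fin (_ : 2 * _ = 8 * n%:R * m * e); last by ring.
  by rewrite /e mulrCA ler_piMr ?(ltW eps0)// ler_pdivrMr// mul1r lerDl.
pose mm := sigma_finite_product mu mu.
pose g n z := ((diff v0 z ^+ 2)%:E * Kn n z)%E.
have [[h mh v0h] _] := v02.
pose gh n z := ((diff h z ^+ 2)%:E * Kn n z)%E.
have dvh : {ae mu2, forall z, OO z -> diff v0 z = diff h z}.
  apply: filterS2 (ae_product1 mu v0h) (ae_product2 mu v0h) => z v1 v2 [z1 z2].
  by rewrite /diff v1// v2.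
have mdh : measurable_fun setT (fun z => (diff h z ^+ 2)%:E).
  apply/measurable_EFinP; apply: measurable_funX.
  by apply: measurable_funB; exact: (measurableT_comp mh).
have mgh n : measurable_fun OO (gh n).
  by apply: measurable_funTS; exact: emeasurable_funM.
have gh0 n z : OO z -> (0 <= gh n z)%E.
  by move=> _; rewrite mule_ge0// lee_fin sqr_ge0.
have ndgh z : OO z -> {homo gh ^~ z : a b / (a <= b)%N >-> (a <= b)%E}.
  move=> _ a b ab; rewrite lee_wpmul2l ?lee_fin ?sqr_ge0//.
  by rewrite le_min !ge_min lexx/= lee_fin ler_nat ab orbT.
have cvK z : Kn n z @[n --> \oo] --> K z.
  rewrite /Kn; case: (K z) (K0 z) => [x x0|_|//].
    apply: cvg_near_cst; exists (Num.truncn x).+1 => // n /= xn.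
    apply/min_idPl; rewrite lee_fin (le_trans (ltW (truncnS_gt x)))//.
    by rewrite ler_nat.
  rewrite (_ : (fun n => _) = fun n => n%:R%:E :> \bar R).
    by apply/cvgeryP; exact: cvgr_idn.
  by apply/funext => n; rewrite min_r// leey.
have := monotone_convergence mm mOO mgh gh0 ndgh.
have -> : (\int[mm]_(z in OO) limn (gh^~ z) = regional_energy Om s v0)%E.
  apply: ae_eq_integralW; apply: filterS dvh => z dvh OOz.
  rewrite -/(diff v0 z) dvh//; apply/cvg_lim => //.
  by apply: cvgeZl.
move=> ->; apply: lime_le.
  apply: ereal_nondecreasing_is_cvgn => a b ab.
  apply: ge0_le_ae_integral; [exact: gh0|exact: gh0|apply: aeW => z OOz].
  exact: ndgh.
apply: nearW => n; apply: le_trans (trunc n).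
rewrite le_eqVlt; apply/orP; left; apply/eqP; apply: ae_eq_integralW.
by apply: filterS dvh => z dvh OOz; rewrite dvh.
Qed.

Lemma ae_time_near0 (T : R) (P : R -> Prop) (delta : R) : 0 < T -> 0 < delta ->
  ae_time T P -> exists t, [/\ 0 < t < T, t < delta & P t].
Proof.
move=> T0 d0 [N [mN N0 PN]]; apply: contrapT => nP.
pose b := Num.min T delta; have b0 : 0 < b by rewrite lt_min T0.
have : (lebesgue_measure `]0%R, b[%classic <= lebesgue_measure N)%E.
  apply: le_measure; rewrite ?inE//.
  move=> t; rewrite /= in_itv/= lt_min => /and3P[t0 tT td].
  apply: PN => /= Pt; apply: nP; exists t; split => //; first by rewrite t0.
  by apply: Pt; rewrite t0.
rewrite [X in (_ <= X)%E]N0 lebesgue_measure_itv/= lte_fin b0 oppr0 adde0.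
by rewrite lee_fin leNgt b0.
Qed.

(** The initial datum is the limit in L^2 of values of [u] at times tending to
    zero, at which the regional energy is bounded. *)
Lemma initial_value_energy (T : R) u u0 : 0 < T -> L2_dom Om u0 ->
  bochner_Linfty T (neumann_space Om s) u -> initial_value Om T u u0 ->
  (regional_energy Om s u0 < +oo)%E.
Proof.
move=> T0 u02 [mu_ [M uM]] [U [U2 Uc Uu Uu0]].
(* [2 * M ^+ 2] bounds the regional energy of [u t]; the limit costs a further
   factor 2 *)
apply: (@le_lt_trans _ _ (2 * (2 * M ^+ 2))%:E); last exact: ltry.
apply: regional_energy_limit => //; first by rewrite mulr_ge0// sqr_ge0.
move=> e e0.
have T00 : (0 : R) <= 0 <= T by apply/andP; split => //; exact: ltW.
have [delta d0 Ud] := Uc 0 T00 _ (etrans (sqrtr_gt0 e) e0).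
have := ae_timeI (ae_timeI (strongly_measurable_dom mu_) uM) Uu.
move=> /(ae_time_near0 T0 d0)[t [/andP[t0 tT] td [[ut utM] Utu]]].
have [mut ut2 utE] := ut.
exists (u t); split => //.
  have r2 : L2_dom Om (fun x => u0 x - u t x).
    have := L2_domD mOm (-1) ut2 u02; congr (L2_dom Om _).
    by apply/funext => x; rewrite mulN1r addrC.
  have := Ud t; rewrite (ltW t0) (ltW tT) subr0 gtr0_norm// => /(_ erefl td).
  rewrite (@L2_norm_ae _ _ _ _ (fun x => u t x - u0 x)); last first.
    by apply: filterS2 Utu Uu0 => x h1 h2 Omx; rewrite h1// h2.
  rewrite /L2_norm ltr_sqrt// => h.
  rewrite (eq_integral (fun x => ((u t x - u0 x) ^+ 2)%:E)); last first.
    by move=> x _; rewrite -sqrrN opprB.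
  rewrite -(@fineK _ (\int[mu]_(x in Om) _)%E) ?lee_fin ?(ltW h)//.
  have -> : (\int[mu]_(x in Om) ((u t x - u0 x) ^+ 2)%:E =
    \int[mu]_(x in Om) ((u0 x - u t x) ^+ 2)%:E)%E.
    by apply: eq_integral => x _; rewrite -sqrrN opprB.
  rewrite ge0_fin_numE; first by case: r2.
  by apply: integral_ge0 => x _; rewrite lee_fin sqr_ge0.
apply: le_trans (regional_energy_le mOm Om_fin bOm s01 mut ut2) _.
rewrite EFinM lee_wpmul2l ?lee_fin//.
have M0 : 0 <= M by apply: le_trans utM; rewrite addr_ge0 ?sqrtr_ge0.
have nf : neumann_energy Om s (u t) \is a fin_num.
  by rewrite ge0_fin_numE// neumann_energy_ge0.
have f0 : 0 <= fine (neumann_energy Om s (u t)).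
  by rewrite fine_ge0// neumann_energy_ge0.
rewrite -(fineK nf) lee_fin -[leLHS]sqr_sqrtr// ler_pXn2r ?nnegrE ?sqrtr_ge0//.
by apply: le_trans utM; rewrite lerDr sqrtr_ge0.
Qed.

End initial_datum.
(** * Equivalence of the two notions of solution *)

Section transfer.
Context (R : realType) (d : nat) (Om : set 'rV[R]_d) (T : R).
Local Notation mu := (leb_rV R d).
Implicit Types (u zeta : R -> 'rV[R]_d -> R) (v phi : 'rV[R]_d -> R).

Lemma L2_embed_eq v v' phi phi' : (forall x, Om x -> v x = v' x) ->
  (forall x, Om x -> phi x = phi' x) ->
  L2_embed Om v phi = L2_embed Om v' phi'.
Proof.
move=> vv' pp'; apply: eq_Rintegral => x /[1!inE] Omx.
by rewrite vv'// pp'.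
Qed.

Lemma ae_selection_eq gamma u u' zeta :
  (forall t x, 0 < t < T -> Om x -> u t x = u' t x) ->
  ae_selection Om T gamma u zeta -> ae_selection Om T gamma u' zeta.
Proof.
move=> uu' [U [Z [mU mZ UZ g]]]; exists U, Z; split => //.
apply: ae_timeS UZ => t tT; apply: filterS => x UZ Omx.
by rewrite -uu'//; exact: UZ.
Qed.

Lemma initial_value_eq u u' (u0 u0' : 'rV[R]_d -> R) :
  (forall t x, 0 < t < T -> Om x -> u t x = u' t x) ->
  (forall x, Om x -> u0 x = u0' x) ->
  initial_value Om T u u0 -> initial_value Om T u' u0'.
Proof.
move=> uu' uu0' [U [U2 Uc Uu Uu0]]; exists U; split => //.
  apply: ae_timeS Uu => t tT; apply: filterS => x Uu Omx.
  by rewrite -uu'//; exact: Uu.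
by apply: filterS Uu0 => x Uu0 Omx; rewrite -uu0'//; exact: Uu0.
Qed.

(** The regional kernel dominates [1 - s] times the fractional kernel. *)
Lemma regional_fractional_sobolev (s : R) v : 0 < s < 1 ->
  fdom (regional_space Om s) v -> fractional_sobolev Om s v.
Proof.
move=> s01 [v2 vE]; split => //.
have c0 : 0 < (1 - s)^-1 by case/andP: s01 => _ s1; rewrite invr_gt0 subr_gt0.
have c1 : 0 < 1 - s by rewrite -invr_gt0.
apply: (@le_lt_trans _ _ ((1 - s)^-1%:E * regional_energy Om s v)%E); last first.
  rewrite lte_mul_pinfty ?lee_fin ?(ltW c0)//.
have R0 z : (0 <= ((v z.1 - v z.2) ^+ 2)%:E * regional_kernel Om s z.1 z.2)%E.
  by rewrite mule_ge0 ?lee_fin ?sqr_ge0// regional_kernel_ge0.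
apply: le_trans; last by apply: ge0_integralZl_le => // z _; exact: R0.
apply: ge0_le_ae_integral.
- by move=> z _; rewrite lee_fin mulr_ge0 ?sqr_ge0// frac_kernel_ge0.
- by move=> z _; rewrite mule_ge0 ?lee_fin ?(ltW c0).
apply: aeW => z _; rewrite muleCA EFinM lee_wpmul2l ?lee_fin ?sqr_ge0//.
rewrite /regional_kernel muleA -EFinM mulVf ?gt_eqF// mul1e leeDl//.
apply: integral_ge0 => y _; rewrite mule_ge0//.
  by rewrite lee_fin mulr_ge0// frac_kernel_ge0.
rewrite inve_ge0; apply: integral_ge0 => x _; rewrite lee_fin.
exact: frac_kernel_ge0.
Qed.

End transfer.

(** The values of [ut t] on the boundary are arbitrary and may depend on [t];
    the boundary being null, [ut t] is still an extension of [u t] as far as the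
    Neumann space can tell. *)
Lemma represents_neumann_extension (R : realType) (d : nat) (Om : set 'rV[R]_d)
    (s T : R) (u ut : R -> 'rV[R]_d -> R) :
  measurable Om -> (leb_rV R d Om < +oo)%E ->
  (leb_rV R d).-negligible (closure Om `\` Om) -> 0 < s < 1 ->
  (forall t x, 0 < t < T -> Om x -> ut t x = u t x) ->
  (forall t x, 0 < t < T -> ~ closure Om x ->
     ut t x = neumann_average Om s (u t) x) ->
  (forall t, 0 < t < T ->
     {ae leb_rV R d, forall x, neumann_extension Om s (u t) x = ut t x}) /\
  represents_image T (regional_space Om s) (neumann_space Om s)
    (neumann_extension Om s) u ut.
Proof.
move=> mOm Of bOm s01 uO uE.
have sN := seminormed_neumann mOm s01.
have bE := bounded_linear_extension mOm Of bOm s01.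
have E t : 0 < t < T ->
    {ae leb_rV R d, forall x, neumann_extension Om s (u t) x = ut t x}.
  move=> tT; apply: (ae_eq_exterior bOm) => x hx.
    by rewrite neumann_extension_in// uO.
  by rewrite neumann_extension_out// uE.
split => // t tT Ru; have Et := E t tT.
have Neu := bounded_linear_dom bE Ru.
have [Nut nE] := neumann_space_ae Et Neu; split => // v Nv.
have : {ae leb_rV R d, forall x, v x - neumann_extension Om s (u t) x = v x - ut t x}.
  by apply: filterS Et => x ->.
by move=> /neumann_space_ae/(_ (fdomB sN Nv Neu))[_ ->].
Qed.

Theorem theorem4p13 (R : realType) (d : nat) (d_gt0 : (0 < d)%N)
  (Om : set 'rV[R]_d) (Om_open : open Om) (Om_bounded : bounded_set Om)
  (Om_C2 : C2_boundary Om)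
  (s sigma T : R) (s01 : 0 < s < 1) (sigma01 : 0 < sigma < 1) (T_gt0 : 0 < T)
  (Gamma : R -> \bar R) (Gamma_ge0 : forall r, (0 <= Gamma r)%E)
  (Gamma_proper : proper_ereal Gamma) (Gamma_convex : convex_ereal Gamma)
  (Gamma_lsc : lower_semicontinuous Gamma) (Gamma0 : Gamma 0 = 0%E)
  (pi : R -> R) (pi_lip : exists L : R, L.-lipschitz pi) (pi0 : pi 0 = 0)
  (F_growth : subquadratic_below
                (fun r => (Gamma r + (primitive0 pi r)%:E)%E))
  (u0 v0 : 'rV[R]_d -> R) (u0v0 : forall x, Om x -> u0 x = v0 x) :
  (forall u w zeta : R -> 'rV[R]_d -> R,
     neumann_weak_solution Om (subdiff Gamma) pi s sigma T u0 u w zeta ->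
     regional_weak_solution Om (subdiff Gamma) pi s sigma T v0
       (fun t => restrict_dom Om (u t)) (fun t => restrict_dom Om (w t)) zeta)
  /\
  (forall u w zeta ut wt : R -> 'rV[R]_d -> R,
     regional_weak_solution Om (subdiff Gamma) pi s sigma T v0 u w zeta ->
     (forall t x, 0 < t < T -> Om x -> ut t x = u t x /\ wt t x = w t x) ->
     (forall t x, 0 < t < T -> ~ closure Om x ->
        ut t x = neumann_average Om s (u t) x /\
        wt t x = neumann_average Om sigma (w t) x) ->
     neumann_weak_solution Om (subdiff Gamma) pi s sigma T u0 ut wt zeta).
Proof.
have mOm := open_measurable_rV Om_open.
have Of := leb_rV_bounded mOm Om_bounded.
have bOm := C2_boundary_negligible Om_open Om_bounded Om_C2.
have sNs := seminormed_neumann mOm s01.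
have sNg := seminormed_neumann mOm sigma01.
have sRs := seminormed_regional mOm s01.
have sRg := seminormed_regional mOm sigma01.
have bEs := bounded_linear_extension mOm Of bOm s01.
have bEg := bounded_linear_extension mOm Of bOm sigma01.
have bRs := bounded_linear_restriction mOm Of bOm s01.
have bRg := bounded_linear_restriction mOm Of bOm sigma01.
split.
- move=> u w zeta [[u02 _] [[uL wL zL sel iv] [du [duW eqX eqV]]]].
  have ru t x : 0 < t < T -> Om x -> u t x = restrict_dom Om (u t) x.
    by move=> _ Omx; rewrite restrict_dom_in.
  split.
    split; first by apply: L2_dom_ae u02; apply: aeW => x /u0v0.
    rewrite -(@regional_energy_ae _ _ _ _ u0); last by apply: aeW => x /u0v0.
    exact: (initial_value_energy mOm Of bOm s01 T_gt0 u02 uL iv).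
  split.
    split => //.
    - apply: (bochner_Linfty_map sNs sRs bRs _ uL).
      exact: (represents_image_refl bRs).
    - apply: (bochner_L2_map sNg sRg bRg _ wL).
      exact: (represents_image_refl bRg).
    - exact: ae_selection_eq sel.
    - exact: initial_value_eq iv.
  exists (fun t => transpose (neumann_extension Om sigma) (du t)); split.
  - apply: (weak_derivative_transpose sRg sNg bEg _ _ duW) => // t tT.
    apply/funext => phi; apply: L2_embed_eq => x Omx.
      by rewrite restrict_dom_in.
    by rewrite neumann_extension_in.
  - apply: ae_timeS (ae_timeI (strongly_measurable_dom wL.1) eqX).
    move=> t tT [Nw eqt] phi Rphi.
    rewrite -(neumann_form_extension_r mOm Of bOm sigma01 Nw Rphi).
    by apply: eqt; exact: (bounded_linear_dom bEg).
  - apply: ae_timeS (ae_timeI (strongly_measurable_dom uL.1) eqV).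
    move=> t tT [Nu eqt] phi Rphi.
    rewrite -(neumann_form_extension_r mOm Of bOm s01 Nu Rphi).
    have := eqt _ (bounded_linear_dom bEs Rphi).
    have e v v' : (forall x, Om x -> v x = v' x) ->
        L2_embed Om v (neumann_extension Om s phi) = L2_embed Om v' phi.
      by move=> vv'; apply: L2_embed_eq => // x Omx; rewrite neumann_extension_in.
    rewrite (e _ (restrict_dom Om (w t))); last by move=> x /restrict_dom_in ->.
    rewrite (e (zeta t) (zeta t))// (e _ (fun x => pi (restrict_dom Om (u t) x)))//.
    by move=> x /restrict_dom_in ->.
- move=> u w zeta ut wt [v0R [[uL wL zL sel iv] [du [duW eqX eqV]]]] inO outO.
  have uO t x : 0 < t < T -> Om x -> ut t x = u t x.
    by move=> tT Omx; have [] := inO t x tT Omx.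
  have wO t x : 0 < t < T -> Om x -> wt t x = w t x.
    by move=> tT Omx; have [] := inO t x tT Omx.
  have [utE utI] := represents_neumann_extension mOm Of bOm s01 uO
    (fun t x tT nx => (outO t x tT nx).1).
  have [wtE wtI] := represents_neumann_extension mOm Of bOm sigma01 wO
    (fun t x tT nx => (outO t x tT nx).2).
  split.
    have [v02 v0E] := regional_fractional_sobolev s01 v0R; split.
      by apply: L2_dom_ae v02; apply: aeW => x /u0v0.
    rewrite (eq_integral (fun z => ((v0 z.1 - v0 z.2) ^+ 2 * frac_kernel s z.1 z.2)%:E))//.
    by move=> z /[1!inE] -[z1 z2]; rewrite !u0v0.
  split.
    split => //.
    - exact: (bochner_Linfty_map sRs sNs bEs utI uL).
    - exact: (bochner_L2_map sRg sNg bEg wtI wL).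
    - by apply: ae_selection_eq sel => t x tT Omx; rewrite uO.
    - apply: initial_value_eq iv => [t x tT Omx|x Omx]; first by rewrite uO.
      by rewrite u0v0.
  exists (fun t => transpose (restrict_dom Om) (du t)); split.
  - apply: (weak_derivative_transpose sNg sRg bRg _ _ duW) => // t tT.
    apply/funext => phi; apply: L2_embed_eq => x Omx; first exact: uO.
    by rewrite restrict_dom_in.
  - apply: ae_timeS (ae_timeI (strongly_measurable_dom wL.1) eqX).
    move=> t tT [Rw eqt] phi Nphi.
    rewrite -(neumann_form_ae Om sigma phi (wtE t tT)).
    rewrite (neumann_form_extension_l mOm Of bOm sigma01 Rw Nphi).
    by apply: eqt; exact: (bounded_linear_dom bRg).
  - apply: ae_timeS (ae_timeI (strongly_measurable_dom uL.1) eqV).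
    move=> t tT [Ru eqt] phi Nphi.
    rewrite -(neumann_form_ae Om s phi (utE t tT)).
    rewrite (neumann_form_extension_l mOm Of bOm s01 Ru Nphi).
    have := eqt _ (bounded_linear_dom bRs Nphi).
    have e v v' : (forall x, Om x -> v x = v' x) ->
        L2_embed Om v (restrict_dom Om phi) = L2_embed Om v' phi.
      by move=> vv'; apply: L2_embed_eq => // x Omx; rewrite restrict_dom_in.
    rewrite (e _ (wt t)); last by move=> x Omx; rewrite wO.
    rewrite (e (zeta t) (zeta t))// (e _ (fun x => pi (ut t x)))//.
    by move=> x Omx; rewrite uO.
Qed.
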